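(* Let $0=s_0<s_1<\cdots<s_k<s_{k+1}=T$, $\mathbf{s}=(s_1,\dots,s_k)$, and let $(\mathbf{x},\mathbf{p})$ be an absolutely continuous solution on $[0,T]$ of the coupled system $$\dot{\mathbf{x}}(t)=\mathbf{F}(\mathbf{x}(t),\mathbf{p}(t),t),\qquad \dot{\mathbf{p}}(t)=-\mathbf{p}(t)\mathbf{F}_x(\mathbf{x}(t),\mathbf{p}(t),t),\qquad (\mathbf{x}(0),\mathbf{p}(0))=(\mathbf{x}_0,\mathbf{p}_0).$$ Suppose that the Generalized State Regularity property (defined in the context) holds at $(\mathbf{x},\mathbf{p})$ and that $C$ is Lipschitz continuously differentiable in a neighborhood of $\mathbf{x}(T)$. Let $\mathbf{y}=(\mathbf{y}_1,\mathbf{y}_2):[0,T]\to\mathbb{R}^{2n}$ (a row vector) be the solution of the linear system $$\dot{\mathbf{y}}_1(t)=-\nabla_x\mathcal{H}_j(\mathbf{x}(t),\mathbf{p}(t),\mathbf{y}(t),t),\quad \mathbf{y}_1(T)=\nabla C(\mathbf{x}(T)),$$ $$\dot{\mathbf{y}}_2(t)=-\nabla_p\mathcal{H}_j(\mathbf{x}(t),\mathbf{p}(t),\mathbf{y}(t),t),\quad \mathbf{y}_2(T)=\mathbf{0},$$ on $(s_j,s_{j+1})$ for $j=k,k-1,\dots,0$. Then for $j=1,2,\dots,k$, $$\frac{\partial C}{\partial s_j}(\mathbf{s},\mathbf{p}_0)=\mathcal{H}_{j-1}(\mathbf{x}(s_j),\mathbf{p}(s_j),\mathbf{y}(s_j)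,s_j)-\mathcal{H}_j(\mathbf{x}(s_j),\mathbf{p}(s_j),\mathbf{y}(s_j),s_j).$$
   Context: Setting. $T>0$ and $\mathbf{x}_0\in\mathbb{R}^n$ are fixed; $\mathbf{f}:\mathbb{R}^n\times\mathbb{R}^m\to\mathbb{R}^n$ and $C:\mathbb{R}^n\to\mathbb{R}$ are differentiable. The control has the form $\mathbf{u}(t)=\boldsymbol{\phi}_j(\mathbf{x}(t),\mathbf{p}(t),t)$ on $(s_j,s_{j+1})$, $0\le j\le k$, where $\mathbf{p}$ (a row vector in $\mathbb{R}^n$) is the costate. Define $$\mathbf{f}_j(\mathbf{x},\mathbf{p},t)=\mathbf{f}(\mathbf{x},\boldsymbol{\phi}_j(\mathbf{x},\mathbf{p},t)),\qquad \mathbf{f}_{jx}(\mathbf{x},\mathbf{p},t)=\nabla_x\mathbf{f}(\mathbf{x},\mathbf{u})\big|_{\mathbf{u}=\boldsymbol{\phi}_j(\mathbf{x},\mathbf{p},t)},$$ where $\nabla_x\mathbf{f}(\mathbf{x},\mathbf{u})$ is the Jacobian of $\mathbf{f}$ in its first argument with $\mathbf{u}$ held fixed, and set $\mathbf{F}(\mathbf{x},\mathbf{p},t)=\mathbf{f}_j(\mathbf{x},\mathbf{p},t)$, $\mathbf{F}_x(\mathbf{x},\mathbf{p},t)=\mathbf{f}_{jx}(\mathbf{x},\mathbf{p},t)$ for $t\in(s_j,s_{j+1})$. Generalized Hamiltonian: for a row vector $\mathbf{y}=(\mathbf{y}_1,\mathbf{y}_2)\in\mathbb{R}^{2n}$ with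 $\mathbf{y}_1,\mathbf{y}_2\in\mathbb{R}^n$, $$\mathcal{H}_j(\mathbf{x},\mathbf{p},\mathbf{y},t)=\mathbf{y}_1\mathbf{f}_j(\mathbf{x},\mathbf{p},t)-\mathbf{p}\,\mathbf{f}_{jx}(\mathbf{x},\mathbf{p},t)\,\mathbf{y}_2^{\mathsf T},\qquad 0\le j\le k.$$ $\nabla_x\mathcal{H}_j$ and $\nabla_p\mathcal{H}_j$ are its gradients (row vectors) with respect to $\mathbf{x}$ and $\mathbf{p}$; $\nabla C$ is a row vector. Differential equations hold at almost every $t$, with absolutely continuous solutions. $C(\mathbf{s},\mathbf{p}_0)$ denotes $C(\mathbf{x}(T))$, where $(\mathbf{x},\mathbf{p})$ solves the coupled system with switching points $\mathbf{s}$ and initial condition $(\mathbf{x}_0,\mathbf{p}_0)$. Generalized State Regularity. There exist constants $\rho>0$, $s_j^-\in(s_{j-1},s_j)$ and $s_j^+\in(s_j,s_{j+1})$, $1\le j\le k$, such that, with $s_0^-=0$ and $s_{k+1}^+=T$, for each $0\le j\le k$ the pair $(\mathbf{f}_j,\mathbf{f}_{jx})$ is continuously differentiable on the tube $\mathcal{T}_j$ consisting of all $(\boldsymbol{\chi},t)$ with $t\in[s_j^-,s_{j+1}^+]$ and $\boldsymbol{\chi}\in\mathbb{R}^{2n}$ in the closed ball of radius $\rho$ centered at $(\mathbf{x}(t),\mathbf{p}(t))$. Moreover $(\mathbf{f}_j(\boldsymbol{\chi},t),\mathbf{f}_{jx}(\boldsymbol{\chi},t))$ is Lipschitz continuously differentiable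 with respect to $\boldsymbol{\chi}$ on $\mathcal{T}_j$ (its derivative in $\boldsymbol{\chi}$ is Lipschitz in $\boldsymbol{\chi}$), uniformly in $j$ and $t\in[s_j^-,s_{j+1}^+]$. *)

(* Defs.v *)
From HB Require Import structures.
From mathcomp Require Import all_boot all_order all_algebra.
From mathcomp Require Import all_classical all_reals all_analysis.

Set Implicit Arguments.
Unset Strict Implicit.
Unset Printing Implicit Defensive.

Import Order.TTheory GRing.Theory Num.Theory.
Import numFieldNormedType.Exports.

Local Open Scope classical_set_scope.
Local Open Scope ring_scope.

(* All vectors (states included) are row vectors, as in the library
   notion [jacobian]; a product "row times column" is therefore
   written with an explicit transpose.  R^(2n) is 'rV_n * 'rV_n. *)

Definition gradient (R : realType) (n : nat) (g : 'rV[R]_n -> R)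
    (a : 'rV[R]_n) : 'rV[R]_n :=
  \row_i 'D_(delta_mx 0 i) g a.

Definition abs_continuous (R : realType) (V : normedModType R) (a b : R)
    (g : R -> V) : Prop :=
  forall e : R, 0 < e -> exists2 d : R, 0 < d &
    forall (N : nat) (u v : 'I_N -> R),
      (forall i, [/\ a <= u i, u i <= v i & v i <= b]) ->
      trivIset setT (fun i => `]u i, v i[%classic) ->
      \sum_i (v i - u i) < d ->
      \sum_i `|g (v i) - g (u i)| < e.

(* [g] is continuously differentiable on the (not necessarily open) set [A],
   with differential [dg]: difference quotients are taken inside [A], so the
   derivatives are one-sided at boundary points of [A], and [dg z] is the usual
   differential when [z] is interior.  For finite-dimensional [V] the pointwise
   continuity of [dg] below is continuity in operator norm. *)
Definition cont_diff_on (R : realType) (V W : normedModType R) (A : set V)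
    (g : V -> W) (dg : V -> {linear V -> W}) : Prop :=
  (forall z, A z -> forall e : R, 0 < e ->
     \forall w \near within A (nbhs z),
       `|g w - g z - dg z (w - z)| <= e * `|w - z|) /\
  (forall v : V, {within A, continuous (fun z => dg z v)}).

(* The entry [s 0 i] is the switching point s_(i+1); the sequence
   s_0 = 0, s_1, ..., s_k, s_(k+1) = T is indexed by nat. *)
Definition switch (R : realType) (k : nat) (T : R) (s : 'rV[R]_k) (j : nat)
    : R :=
  nth T (0 :: [seq s 0 i | i : 'I_k]) j.

Section SwitchedSystem.
Variables (R : realType) (n m k : nat) (T : R).
Variable f : 'rV[R]_n -> 'rV[R]_m -> 'rV[R]_n.
(* only the feedback laws phi 0, ..., phi k are ever used *)
Variable phi : nat -> 'rV[R]_n -> 'rV[R]_n -> R -> 'rV[R]_m.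

Definition dyn (j : nat) (x p : 'rV[R]_n) (t : R) : 'rV[R]_n :=
  f x (phi j x p t).

(* the control is frozen at u = phi j x p t before differentiating in x; the
   transpose turns the library's row-vector Jacobian into (df_i/dx_l)_(i,l) *)
Definition dynx (j : nat) (x p : 'rV[R]_n) (t : R) : 'M[R]_n :=
  (jacobian (f^~ (phi j x p t)) x)^T.

Definition hamiltonian (j : nat) (x p y1 y2 : 'rV[R]_n) (t : R) : R :=
  (y1 *m (dyn j x p t)^T - p *m dynx j x p t *m y2^T) 0 0.

Definition coupled_solution (s : 'rV[R]_k) (x0 p0 : 'rV[R]_n)
    (x p : R -> 'rV[R]_n) : Prop :=
  [/\ abs_continuous 0 T x, abs_continuous 0 T p, x 0 = x0, p 0 = p0 &
      forall j, (j <= k)%N ->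
        {ae lebesgue_measure, forall t : R,
           switch T s j < t < switch T s j.+1 ->
           is_derive t 1 x (dyn j (x t) (p t) t) /\
           is_derive t 1 p (- (p t *m dynx j (x t) (p t) t))}].

Definition adjoint_solution (C : 'rV[R]_n -> R) (s : 'rV[R]_k)
    (x p y1 y2 : R -> 'rV[R]_n) : Prop :=
  [/\ abs_continuous 0 T y1, abs_continuous 0 T y2,
      y1 T = gradient C (x T), y2 T = 0 &
      forall j, (j <= k)%N ->
        {ae lebesgue_measure, forall t : R,
           switch T s j < t < switch T s j.+1 ->
           is_derive t 1 y1
             (- gradient (fun z => hamiltonian j z (p t) (y1 t) (y2 t) t)
                         (x t)) /\
           is_derive t 1 y2
             (- gradient (fun q => hamiltonian j (x t) q (y1 t) (y2 t) t)
                         (p t))}].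

(* the cost C(s, p0) = C(x(T)); the terminal state is the one reached by a
   solution for the switching points s (0 if there is no solution) *)
Definition cost (C : 'rV[R]_n -> R) (x0 : 'rV[R]_n) (s : 'rV[R]_k)
    (p0 : 'rV[R]_n) : R :=
  C (xget 0 [set xT | exists x p, coupled_solution s x0 p0 x p /\ x T = xT]).

Definition tube (x p : R -> 'rV[R]_n) (rho a b : R)
    : set ('rV[R]_n * 'rV[R]_n * R) :=
  [set z | a <= z.2 <= b /\ closed_ball (x z.2, p z.2) rho z.1].

(* [dg z (v, 0)] is the derivative of (f_j, f_jx) with respect to chi = (x, p)
   in the direction [v].  Balls and Lipschitz bounds use the library's max
   norm, which is equivalent to the Euclidean one; [rho] and [L] are
   existentially quantified. *)
Definition generalized_state_regularity (s : 'rV[R]_k) (x p : R -> 'rV[R]_n)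
    : Prop :=
  exists (rho : R) (sm sp : nat -> R) (L : R),
    [/\ 0 < rho,
        sm 0%N = 0 /\ sp k.+1 = T,
        (forall j, (1 <= j <= k)%N ->
           switch T s j.-1 < sm j < switch T s j /\
           switch T s j < sp j < switch T s j.+1) &
        forall j, (j <= k)%N ->
          let Tj := tube x p rho (sm j) (sp j.+1) in
          exists dg : 'rV[R]_n * 'rV[R]_n * R ->
              {linear ('rV[R]_n * 'rV[R]_n * R)%type -> ('rV[R]_n * 'M[R]_n)%type},
            cont_diff_on Tj
              (fun z => (dyn j z.1.1 z.1.2 z.2, dynx j z.1.1 z.1.2 z.2)) dg /\
            (forall (t : R) (c1 c2 v : 'rV[R]_n * 'rV[R]_n),
               Tj (c1, t) -> Tj (c2, t) ->
               `|dg (c1, t) (v, 0) - dg (c2, t) (v, 0)|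
                 <= L * `|c1 - c2| * `|v|)].

End SwitchedSystem.

(* Main.v *)
Require Import Defs.
From HB Require Import structures.
From mathcomp Require Import all_boot all_order all_algebra.
From mathcomp Require Import all_classical all_reals all_analysis.
From mathcomp Require Import ring lra.

Set Implicit Arguments.
Unset Strict Implicit.
Unset Printing Implicit Defensive.

Import Order.TTheory GRing.Theory Num.Theory.
Import numFieldNormedType.Exports.

Local Open Scope classical_set_scope.
Local Open Scope ring_scope.

(** Write z = (x, p), and let G_i(z, t) = (f_i(z, t), - p f_ix(z, t)) be the right-hand side of
    the coupled system in phase i.  The generalized Hamiltonian is the pairing <y, G_i(z, t)>
    ([hamiltonianE]), and the adjoint equation says that <y', v> = - <y, D_z G_i v> for all v
    ([adjoint_pairing]).

    Move the switching point tau to tau + h, let z^h be a solution of the shifted system and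
    delta = z^h - z.  Where both trajectories follow the same field, <y, delta> has the
    derivative <y, G_i(z + delta) - G_i(z) - D_z G_i delta>, which is quadratic in delta because
    the derivative of the field is Lipschitz in the tube ([costate_field_bounds]).  Between tau
    and tau + h the two fields differ, and the derivative contains in addition the difference
    of the Hamiltonians of the two phases.  Since delta = O(h) by the Gronwall inequality
    ([drift_bound]), the value of <y, delta> at T is h times the difference of the Hamiltonians
    at tau, up to o(h) ([first_order_effect]).  At T this value is the differential of C applied
    to x^h(T) - x(T), because y(T) is the pair of the gradient of C and 0.

    The cost is a function of switching points only through solutions of the shifted
    system.  One exists by Picard iteration around the unshifted trajectory
    ([picard_solution], [shifted_solution]), and every one of them stays in the tube and obeys
    the same estimates, so it does not matter which one defines the cost; for h = 0 the
    estimate gives uniqueness.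

    All differential inequalities are integrated by one tool, [mean_value_ae]: the increment
    of an absolutely continuous curve is bounded by that of a nondecreasing function whose
    derivative dominates almost everywhere.  The comparison functions contain [mismatch], the
    time spent between tau and tau + h, so that each inequality is integrated once over the
    whole horizon rather than phase by phase. *)

(** * Real induction and derivatives of curves *)

(** The supremum of the [t] such that [P a t] is attained and equals [b]: the
    local hypothesis at the supremum would otherwise extend [P a] beyond it. *)
Lemma cousin (R : realType) (P : R -> R -> Prop) (a b : R) : a <= b ->
  (forall u v w, a <= u -> u <= v -> v <= w -> w <= b ->
     P u v -> P v w -> P u w) ->
  (forall t, a <= t <= b -> exists2 d : R, 0 < d &
     forall u v, a <= u -> u <= t -> t <= v -> v <= b -> v - u < d -> P u v) ->
  P a b.
Proof.
move=> ab Padd Ploc.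
pose S := [set t | a <= t <= b /\ P a t].
have Paa : P a a.
  have [|d d0 Pd] := Ploc a; first by rewrite lexx.
  by apply: Pd; rewrite ?lexx// subrr.
have Sa : S a by split=> //; rewrite lexx.
have ubS : ubound S b by move=> t [/andP[]].
have hS : has_sup S by split; [exists a | exists b].
pose c := sup S.
have cb : c <= b by apply: ge_sup => //; exists a.
have ac : a <= c by apply: ub_le_sup => //; exists b.
have [|d d0 Pd] := Ploc c; first by rewrite ac.
have [t [/andP[at_ tb] Pat] ct] : exists2 t, S t & c - d / 2 < t.
  have [|t St tc] := @sup_adherent _ S (d / 2) _ hS; first by rewrite divr_gt0.
  by exists t.
have tc : t <= c by apply: ub_le_sup; [exists b | split=> //; apply/andP].
pose v := Num.min b (c + d / 3).
have cv : c <= v by rewrite /v le_min cb; lra.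
have vb : v <= b by rewrite /v ge_min lexx.
have vc : v <= c + d / 3 by rewrite /v ge_min lexx orbT.
have Pav : P a v.
  apply: (Padd a t v) => //; first exact: le_trans cv.
  by apply: Pd => //; lra.
have vc' : v <= c.
  by apply: ub_le_sup; [exists b | split=> //; rewrite vb (le_trans ac cv)].
have bv : b = v.
  by move: vc'; rewrite /v minElt; case: ifP => // _; lra.
by rewrite bv.
Qed.

Lemma subrACA (M : zmodType) (a b c d : M) : (a - b) - (c - d) = (a - c) - (b - d).
Proof. by rewrite opprD addrACA -opprD. Qed.

(** Difference quotients are awkward to combine with the norm of a product space;
    this form has no division. *)
Lemma is_derive_epsP (R : realType) (V W : normedModType R) (f : V -> W)
    (a v : V) (l : W) :
  is_derive a v f l <-> forall e : R, 0 < e ->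
    \forall h \near (0 : R), `|f (h *: v + a) - f a - h *: l| <= e * `|h|.
Proof.
have E (h : R) : h != 0 -> h^-1 *: (f (h *: v + a) - f a) - l =
    h^-1 *: (f (h *: v + a) - f a - h *: l).
  by move=> h0; rewrite [in RHS]scalerBr scalerA mulVf// scale1r.
split=> [[dg gl]|gl].
- have cv : h^-1 *: ((f \o shift a) (h *: v) - f a) @[h --> 0^'] --> l.
    by rewrite -gl; exact: dg.
  move=> e e0; move/cvgrPdist_le : cv => /(_ e e0) /= [d /= d0 Hd].
  apply/nbhs_ballP; exists d => //= h hd.
  have [->|h0] := eqVneq h 0.
    by rewrite !scale0r add0r subrr subr0 !normr0 mulr0.
  have := Hd h hd h0; rewrite distrC /= E// normrZ normfV ler_pdivrMl ?normr_gt0//.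
  by rewrite mulrC.
- have cv : h^-1 *: ((f \o shift a) (h *: v) - f a) @[h --> 0^'] --> l.
    apply/cvgrPdist_le => e e0; near=> h.
    have h0 : h != 0 by near: h; exact: nbhs_dnbhs_neq.
    rewrite distrC /= E// normrZ normfV ler_pdivrMl ?normr_gt0// mulrC.
    by near: h; apply: nbhs_dnbhs; exact: gl.
  have dg : derivable f a v by apply/cvg_ex; exists l.
  by apply: DeriveDef => //; exact: cvg_lim cv.
Unshelve. all: by end_near.
Qed.

Section Derivative.
Variables (R : realType) (V : normedModType R).
Implicit Types (g : R -> V) (t : R) (l : V).

(** The case [v = 1] of the previous lemma, centered at [t] rather than at [0]. *)
Definition has_deriv g t l := forall e : R, 0 < e ->
  \forall u \near t, `|g u - g t - (u - t) *: l| <= e * `|u - t|.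

Lemma has_derivP g t l : has_deriv g t l <-> is_derive t 1 g l.
Proof.
rewrite is_derive_epsP; split=> gl e e0.
- have /nbhs_ballP[d /= d0 Hd] := gl e e0.
  apply/nbhs_ballP; exists d => //= h.
  rewrite /ball/= sub0r normrN => hd; rewrite [h *: 1]mulr1.
  have := Hd (h + t); rewrite addrK; apply.
  by rewrite /ball/= opprD addrCA subrr addr0 normrN.
- have /nbhs_ballP[d /= d0 Hd] := gl e e0.
  apply/nbhs_ballP; exists d => //= u ut.
  have := Hd (u - t); rewrite [_ *: 1]mulr1 subrK; apply.
  by rewrite /ball/= sub0r normrN distrC.
Qed.

(** The increment over an interval that contains [t], not necessarily as an
    endpoint; this is what an additive interval argument can use. *)
Lemma has_deriv_straddle g t l (e : R) : has_deriv g t l -> 0 < e ->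
  exists2 d : R, 0 < d & forall u v, u <= t -> t <= v -> v - u < d ->
    `|g v - g u - (v - u) *: l| <= e * (v - u).
Proof.
move=> gl e0; have /nbhs_ballP[d /= d0 Hd] := gl e e0.
exists d => // u v ut tv uvd.
have Hu := Hd u; have Hv := Hd v; rewrite /ball/= in Hu Hv.
have {}Hu : `|g u - g t - (u - t) *: l| <= e * (t - u).
  rewrite -[X in e * X](@ger0_norm _ (t - u)) ?subr_ge0// (distrC t u).
  by apply: Hu; rewrite ger0_norm ?subr_ge0//; lra.
have {}Hv : `|g v - g t - (v - t) *: l| <= e * (v - t).
  rewrite -[X in e * X](@ger0_norm _ (v - t)) ?subr_ge0//; apply: Hv.
  by rewrite distrC ger0_norm ?subr_ge0//; lra.
have -> : g v - g u - (v - u) *: l =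
   (g v - g t - (v - t) *: l) - (g u - g t - (u - t) *: l).
  have -> : v - u = (v - t) - (u - t) by ring.
  rewrite (scalerBl (v - t)) [RHS]subrACA; congr (_ - _).
  by rewrite opprB addrA subrK.
apply: le_trans (ler_normB _ _) _; lra.
Qed.

End Derivative.

(** * A mean value inequality for absolutely continuous curves *)

Section MeanValue.
Variables (R : realType).
Local Notation mu := (@lebesgue_measure R).

Lemma disjoint_length_le (O : set R) N (u v : 'I_N -> R) :
  measurable O -> (forall i, u i <= v i) ->
  (forall i, `]u i, v i[ `<=` O) ->
  trivIset setT (fun i => `]u i, v i[%classic) ->
  ((\sum_i (v i - u i))%:E <= mu O)%E.
Proof.
move=> mO uv sub tI.
have -> : ((\sum_i (v i - u i))%:E = \sum_i mu `]u i, v i[%classic)%E.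
  rewrite -sumEFin; apply: eq_bigr => i _; rewrite lebesgue_measure_itv/= lte_fin.
  case: ltgtP (uv i) => // -> _; by rewrite subrr.
rewrite -measure_semi_additive_ord//; last first.
  by apply: bigsetU_measurable => i _; exact: measurable_itv.
apply: (le_measure mu); rewrite ?inE//.
  by apply: bigsetU_measurable => i _; exact: measurable_itv.
by apply: (big_ind (fun X : set R => X `<=` O)) => // A B AO BO; rewrite subUset.
Qed.

(** The exceptional null set is covered by an open set [U] of measure less than the
    modulus [d] given by absolute continuity.  By real induction, the segment is cut into
    intervals of two kinds: those around a good point, where the increment of [g] is at
    most that of [m] up to a small multiple of the length, and those contained in [U],
    which contribute little because their total length is less than [d].  The second
    kind is recorded in the list [S]. *)
Lemma mean_value_ae (V : normedModType R) (g : R -> V) (m : R -> R) (a b : R) :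
  a <= b -> abs_continuous a b g ->
  (forall u v, a <= u -> u <= v -> v <= b -> m u <= m v) ->
  {ae mu, forall t, a < t < b -> exists (l : V) (c : R),
     [/\ has_deriv g t l, has_deriv m t c & `|l| <= c]} ->
  `|g b - g a| <= m b - m a.
Proof.
move=> ab acg mm [N [mN N0 bad]].
apply/ler_addgt0Pr => e e0.
have e20 : 0 < e / 2 by rewrite divr_gt0.
have [d d0 Hd] := acg _ e20.
pose e1 := e / (4 * (b - a + 1)).
have e10 : 0 < e1 by rewrite divr_gt0// mulr_gt0//; lra.
(* the hypothesis says nothing at the endpoints, so they are added to the null set *)
pose D := N `|` ([set a] `|` [set b]).
have mD : measurable D.
  by apply: measurableU => //; apply: measurableU; exact: measurable_set1.
have D0 : mu D = 0%E.
  apply: measure_negligible => //; apply: negligibleU.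
    by apply/negligibleP.
  by apply: negligibleU; apply/negligibleP => //; exact: lebesgue_measure_set1.
have [U [oU DU UDd]] := lebesgue_regularity_outer mD
  (eq_ind_r (fun x => (x < +oo)%E) (ltry 0) D0) d0.
have mU : measurable U by exact: measurable_realfun.open_measurable.
have Ud : (mu U < d%:E)%E.
  apply: le_lt_trans UDd.
  have {1}-> : U = (U `\` D) `|` D by rewrite setUC setDUK.
  apply: le_trans (measureU2 mu _ mD) _; first exact: measurableD.
  by rewrite [X in (_ + X)%E]D0 adde0.
pose P u v := exists S : seq (R * R),
  [/\ all (fun p => [&& u <= p.1, p.1 <= p.2 & p.2 <= v]) S,
      pairwise (fun p q => p.2 <= q.1) S,
      forall p, p \in S -> `]p.1, p.2[ `<=` U
    & `|g v - g u| <= m v - m u + 2 * e1 * (v - u)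
        + \sum_(p <- S) `|g p.2 - g p.1| ].
have : P a b.
  apply: cousin => //.
  - move=> u v w au uv vw wb [S1 [S1i S1p S1U S1g]] [S2 [S2i S2p S2U S2g]].
    exists (S1 ++ S2); split.
    + rewrite all_cat; apply/andP; split.
        by apply: sub_all S1i => p /and3P[-> -> /le_trans ->].
      by apply: sub_all S2i => p /and3P[/(le_trans uv) -> -> ->].
    + rewrite pairwise_cat S1p S2p !andbT; apply/allrelP => p q pS qS.
      have /and3P[_ _ h1] := allP S1i _ pS.
      have /and3P[h2 _ _] := allP S2i _ qS.
      exact: le_trans h2.
    + by move=> p; rewrite mem_cat => /orP[/S1U|/S2U].
    + rewrite big_cat/=.
      have -> : g w - g u = (g v - g u) + (g w - g v) by rewrite [RHS]addrC [RHS]addrA subrK.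
      apply: le_trans (ler_normD _ _) _.
      apply: le_trans (lerD S1g S2g) _; lra.
  - move=> t /andP[a_t tb].
    have [Dt|Dt] := pselect (D t).
    + have /nbhs_ballP[r /= r0 Hr] : nbhs t U by apply: open_nbhs_nbhs; split=> //; exact: DU.
      exists r => // u v au ut tv vb uvr; exists [:: (u, v)]; split => //=.
      * by rewrite !lexx (le_trans ut tv).
      * move=> p; rewrite inE => /eqP -> y /=; rewrite in_itv/= => /andP[uy yv].
        apply: Hr; rewrite /ball/= ltr_norml; apply/andP; split; move: ut tv uy yv uvr; lra.
      * rewrite big_seq1/= lerDr addr_ge0//; last first.
          by apply: mulr_ge0; [apply: mulr_ge0 => //; exact: ltW|lra].
        by rewrite subr_ge0; apply: mm => //; exact: le_trans tv.
    + have atb : a < t < b.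
        rewrite !lt_neqAle a_t tb !andbT; apply/andP; split; apply/eqP => E; apply: Dt.
          by right; left.
        by right; right.
      have [l [c [gl mc lc]]] : exists (l : V) (c : R),
          [/\ has_deriv g t l, has_deriv m t c & `|l| <= c].
        apply: contrapT => K; apply: Dt; left; apply: bad => /= H; exact/K/H.
      have [d1 d10 Hd1] := has_deriv_straddle gl e10.
      have [d2 d20 Hd2] := has_deriv_straddle mc e10.
      exists (Num.min d1 d2); first by rewrite lt_min d10.
      move=> u v au ut tv vb; rewrite lt_min => /andP[uv1 uv2].
      exists [::]; split=> //; rewrite big_nil addr0.
      have uv : 0 <= v - u by lra.
      have {}Hd1 := Hd1 _ _ ut tv uv1.
      have := Hd2 _ _ ut tv uv2; rewrite ler_norml => /andP[{}Hd2 _].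
      have : `|g v - g u| <= e1 * (v - u) + (v - u) * `|l|.
        rewrite -[g v - g u](subrK ((v - u) *: l)).
        apply: le_trans (ler_normD _ _) _.
        by rewrite normrZ (ger0_norm uv) lerD2r.
      have := ler_wpM2l uv lc; rewrite [(v - u) *: c]/GRing.scale/= in Hd2; lra.
case=> S [Si Sp SU Sg].
apply: le_trans Sg _; rewrite -addrA lerD2l.
have H1 : 2 * e1 * (b - a) <= e / 2.
  have -> : 2 * e1 * (b - a) = e / 2 * ((b - a) / (b - a + 1)).
    by rewrite /e1; field; lra.
  by rewrite ler_piMr ?(ltW e20)// ler_pdivrMr; lra.
suff : \sum_(p <- S) `|g p.2 - g p.1| < e / 2 by lra.
pose x0 : R * R := (0, 0).
rewrite (big_nth x0) big_mkord.
have Si' (i : 'I_(size S)) := allP Si _ (mem_nth x0 (ltn_ord i)).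
have tI : trivIset setT (fun i : 'I_(size S) => `](nth x0 S i).1, (nth x0 S i).2[%classic).
  have K (i j : 'I_(size S)) : (i < j)%N ->
     `](nth x0 S i).1, (nth x0 S i).2[%classic `&` `](nth x0 S j).1, (nth x0 S j).2[%classic = set0.
    move=> ij; have := (pairwiseP x0 Sp) i j (ltn_ord i) (ltn_ord j) ij.
    rewrite -subset0 => ? y /=; rewrite !in_itv/= => -[/andP[_ h1] /andP[h2 _]]; lra.
  apply/trivIsetP => i j _ _; rewrite neq_ltn => /orP[/K//|/K].
  by rewrite setIC.
apply: (Hd (size S) (fun i => (nth x0 S i).1) (fun i => (nth x0 S i).2)) => //.
- by move=> i; have /and3P[-> -> ->] := Si' i.
- rewrite -lte_fin; apply: le_lt_trans Ud; apply: disjoint_length_le => // i.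
    by have /and3P[_ -> _] := Si' i.
  by apply: SU; exact: mem_nth.
Qed.

End MeanValue.

(** * Clamping, absolute continuity and rules of derivation *)

Lemma near_dist (R : realType) (t d : R) : 0 < d -> \forall u \near t, `|u - t| < d.
Proof.
move=> d0; apply/nbhs_ballP; exists d => //= u; by rewrite /ball/= distrC.
Qed.

Section Clamp.
Variable R : realType.
Implicit Types a b t u v : R.

(** The retraction of the line onto the segment from [a] to [b]; composing with it
    turns continuity on a segment into continuity everywhere. *)
Definition clamp a b t : R := Num.max a (Num.min b t).

Lemma clamp_in a b t : a <= b -> a <= clamp a b t <= b.
Proof.
by move=> ab; rewrite /clamp le_max lexx ge_max ab/= ge_min lexx.
Qed.

Lemma clamp_id a b t : a <= t <= b -> clamp a b t = t.
Proof.
by move=> /andP[a_t tb]; rewrite /clamp (min_idPr tb) (max_idPr a_t).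
Qed.

Lemma clamp_left a b t : a <= b -> t <= a -> clamp a b t = a.
Proof.
by move=> ab ta; rewrite /clamp (min_idPr (le_trans ta ab)) (max_idPl ta).
Qed.

Lemma clamp_right a b t : a <= b -> b <= t -> clamp a b t = b.
Proof. by move=> ab bt; rewrite /clamp (min_idPl bt) (max_idPr ab). Qed.

Lemma clamp_mono a b u v : u <= v -> clamp a b u <= clamp a b v.
Proof. by move=> uv; rewrite /clamp ge_max le_max lexx/= le_max le_min !ge_min lexx uv !orbT. Qed.

Lemma clamp_lip a b u v : u <= v -> clamp a b v - clamp a b u <= v - u.
Proof.
move=> uv; rewrite /clamp.
case: (leP b u) => ?; case: (leP b v) => ?; rewrite ?maxEle; do 2?case: ifP; lra.
Qed.

Lemma clamp_norm_lip a b u v : `|clamp a b v - clamp a b u| <= `|v - u|.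
Proof.
wlog uv : u v / u <= v.
  by move=> H; case: (leP u v) => [/H//|/ltW/H]; rewrite distrC (distrC u).
by rewrite !ger0_norm ?subr_ge0 ?clamp_mono ?clamp_lip.
Qed.

Lemma continuous_clamp a b : continuous (clamp a b).
Proof.
move=> t; apply/cvgrPdist_le => e e0.
apply: filterS (near_dist t e0) => u ut.
by apply: le_trans (clamp_norm_lip _ _ _ _) _; rewrite distrC ltW.
Qed.

End Clamp.

Section AbsoluteContinuity.
Variables (R : realType) (V : normedModType R).
Implicit Types (g : R -> V) (a b : R).

Lemma abs_continuous_unif g a b : abs_continuous a b g ->
  forall e : R, 0 < e -> exists2 d : R, 0 < d &
    forall u v, a <= u <= b -> a <= v <= b -> `|u - v| < d -> `|g u - g v| < e.
Proof.
move=> acg e e0; have [d d0 Hd] := acg e e0; exists d => // u v.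
wlog uv : u v / u <= v.
  move=> H; case: (leP u v) => [/H//|/ltW/H K] uab vab.
  by rewrite distrC (distrC (g u)); exact: K.
move=> /andP[au ub] /andP[av vb]; rewrite distrC ger0_norm ?subr_ge0// => uvd.
have := Hd 1%N (fun=> u) (fun=> v); rewrite !big_ord1 distrC; apply => //.
by apply/trivIsetP => i j _ _; rewrite !ord1.
Qed.

Lemma abs_continuous_sub g a b a' b' : a <= a' -> b' <= b ->
  abs_continuous a b g -> abs_continuous a' b' g.
Proof.
move=> aa bb acg e e0; have [d d0 Hd] := acg e e0; exists d => // N u v uv.
apply: Hd => i; have [h1 h2 h3] := uv i; split=> //.
  exact: le_trans h1.
exact: le_trans bb.
Qed.

Lemma continuous_abs_clamp g a b : a <= b -> abs_continuous a b g ->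
  continuous (g \o clamp a b).
Proof.
move=> ab /abs_continuous_unif H t; apply/cvgrPdist_le => e e0.
have [d d0 Hd] := H e e0; apply: filterS (near_dist t d0) => u ut.
rewrite /= ltW//; apply: Hd; [exact: clamp_in|exact: clamp_in|].
by apply: le_lt_trans (clamp_norm_lip _ _ _ _) _; rewrite distrC.
Qed.

Lemma lipschitz_abs_continuous g a b (K : R) :
  (forall u v, a <= u -> u <= v -> v <= b -> `|g v - g u| <= K * (v - u)) ->
  abs_continuous a b g.
Proof.
move=> H e e0.
have K0 : 0 < `|K| + 1 by rewrite ltr_wpDl.
exists (e / (`|K| + 1)); first by rewrite divr_gt0.
move=> N u v uv _ S; rewrite ltr_pdivlMr// in S.
apply: le_lt_trans S; rewrite mulrC mulr_sumr; apply: ler_sum => i _.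
have [au uvi vb] := uv i; apply: le_trans (H _ _ au uvi vb) _.
rewrite ler_wpM2r ?subr_ge0//; apply: le_trans (ler_norm _) _; lra.
Qed.

(** Sums, pairs, projections and products of bounded curves are all dominated in this
    sense, so this single lemma replaces a list of closure properties. *)
Lemma abs_continuous_dom (V1 V2 : normedModType R) g (g1 : R -> V1)
    (g2 : R -> V2) a b (K : R) :
  (forall u v, a <= u -> u <= v -> v <= b ->
     `|g v - g u| <= K * (`|g1 v - g1 u| + `|g2 v - g2 u|)) ->
  abs_continuous a b g1 -> abs_continuous a b g2 -> abs_continuous a b g.
Proof.
move=> H ac1 ac2 e e0.
have K0 : 0 < `|K| + 1 by rewrite ltr_wpDl.
have e20 : 0 < e / (`|K| + 1) / 2 by rewrite !divr_gt0.
have [d1 d10 H1] := ac1 _ e20; have [d2 d20 H2] := ac2 _ e20.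
exists (Num.min d1 d2); first by rewrite lt_min d10.
move=> N u v uv tI; rewrite lt_min => /andP[S1 S2].
have {}H1 := H1 _ _ _ uv tI S1; have {}H2 := H2 _ _ _ uv tI S2.
apply: (@le_lt_trans _ _ ((`|K| + 1) * (\sum_i `|g1 (v i) - g1 (u i)| +
    \sum_i `|g2 (v i) - g2 (u i)|))).
  rewrite -big_split mulr_sumr; apply: ler_sum => i _.
  have [au uvi vb] := uv i; apply: le_trans (H _ _ au uvi vb) _.
  by rewrite ler_wpM2r ?addr_ge0//; apply: le_trans (ler_norm _) _; lra.
by rewrite mulrC -ltr_pdivlMr//; lra.
Qed.

End AbsoluteContinuity.

Section DerivativeRules.
Variables (R : realType).

Lemma has_deriv_near (V : normedModType R) (g f : R -> V) t l :
  (\forall u \near t, f u = g u) -> has_deriv g t l -> has_deriv f t l.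
Proof.
move=> fg gl e e0; have ft : f t = g t by exact: nbhs_singleton fg.
by near=> u; rewrite ft (near fg u)//; near: u; exact: gl.
Unshelve. all: by end_near.
Qed.

Lemma has_derivB (V : normedModType R) (g f : R -> V) t l k :
  has_deriv g t l -> has_deriv f t k ->
  has_deriv (fun u => g u - f u) t (l - k).
Proof. by move=> /has_derivP gl /has_derivP fk; apply/has_derivP; exact: is_deriveB. Qed.

Lemma has_derivD (V : normedModType R) (g f : R -> V) t l k :
  has_deriv g t l -> has_deriv f t k ->
  has_deriv (fun u => g u + f u) t (l + k).
Proof. by move=> /has_derivP gl /has_derivP fk; apply/has_derivP; exact: is_deriveD. Qed.

Lemma has_deriv_cst (V : normedModType R) (c : V) t : has_deriv (fun=> c) t 0.
Proof. by apply/has_derivP; exact: is_derive_cst. Qed.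

Lemma has_deriv_id t : has_deriv (fun u : R => u) t 1.
Proof. by apply/has_derivP; exact: is_derive_id. Qed.

Lemma has_deriv_scale (c : R) (f : R -> R) t k :
  has_deriv f t k -> has_deriv (fun u => c * f u) t (c * k).
Proof.
by move=> /has_derivP fk; apply/has_derivP; exact: (@is_deriveZ _ _ _ f c t 1 k).
Qed.

Lemma has_deriv_pair (V W : normedModType R) (g : R -> V) (f : R -> W) t l k :
  has_deriv g t l -> has_deriv f t k ->
  has_deriv (fun u => (g u, f u)) t (l, k).
Proof.
move=> gl fk e e0; have h1 := gl e e0; have h2 := fk e e0.
apply: filterS2 h1 h2 => u h1 h2.
by rewrite /Num.norm/= ge_max; apply/andP; split.
Qed.

Lemma has_deriv_cvg (V : normedModType R) (g : R -> V) t l :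
  has_deriv g t l -> exists2 K : R, 0 < K &
    \forall u \near t, `|g u - g t| <= K * `|u - t|.
Proof.
move=> gl; exists (`|l| + 1); first by rewrite ltr_wpDl.
near=> u.
have : `|g u - g t - (u - t) *: l| <= 1 * `|u - t| by near: u; exact: gl.
move=> h; rewrite -[g u - g t](subrK ((u - t) *: l)).
apply: le_trans (ler_normD _ _) _; rewrite normrZ.
by rewrite mulrDl addrC (mulrC `|l|) lerD2l.
Unshelve. all: by end_near.
Qed.

(** The increment of [B (Y u) (d u)] splits into the two expected linear terms and
    the term [B (Y u - Y t) (d u - d t)], which is quadratic in [u - t]. *)
Lemma has_deriv_bilinear (V : normedModType R) (B : V -> V -> R) (D : R)
    (Y d : R -> V) t Y' d' :
  (forall a b c, B (a - b) c = B a c - B b c) ->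
  (forall a b c, B c (a - b) = B c a - B c b) ->
  (forall k a b, B (k *: a) b = k * B a b) ->
  (forall k a b, B a (k *: b) = k * B a b) ->
  (forall a b, `|B a b| <= D * `|a| * `|b|) ->
  has_deriv Y t Y' -> has_deriv d t d' ->
  has_deriv (fun u => B (Y u) (d u)) t (B Y' (d t) + B (Y t) d').
Proof.
move=> Bl Br Zl Zr BD YY dd e e0.
have [K1 K10 HK1] := has_deriv_cvg YY; have [K2 K20 HK2] := has_deriv_cvg dd.
pose D1 := `|D| + 1.
have D10 : 0 < D1 by rewrite ltr_wpDl.
have {BD}BD a b : `|B a b| <= D1 * `|a| * `|b|.
  apply: le_trans (BD _ _) _; rewrite !ler_wpM2r//.
  by apply: le_trans (ler_norm _) _; rewrite /D1; lra.
pose M := D1 * (`|d t| + `|Y t| + K1 * K2 + 1).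
have M0 : 0 < M.
  rewrite mulr_gt0// ltr_wpDl// !addr_ge0// mulr_ge0// ltW//.
have eM0 : 0 < e / M by rewrite divr_gt0.
apply: filterS (filterI (filterI (YY _ eM0) (dd _ eM0))
  (filterI (filterI HK1 HK2) (near_dist t eM0))) => u [[h1 h2] [[k1 k2] rM]].
set r := `|u - t| in h1 h2 k1 k2 rM *.
have r0 : 0 <= r by exact: normr_ge0.
move/ltW : rM => rM.
have -> : B (Y u) (d u) - B (Y t) (d t) - (u - t) *: (B Y' (d t) + B (Y t) d')
  = B (Y u - Y t - (u - t) *: Y') (d t) + B (Y t) (d u - d t - (u - t) *: d')
    + B (Y u - Y t) (d u - d t).
  by rewrite !(Bl, Br, Zl, Zr) [_ *: _]/GRing.scale/=; ring.
have H1 : `|B (Y u - Y t - (u - t) *: Y') (d t)| <= D1 * (e / M * r) * `|d t|.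
  apply: le_trans (BD _ _) _; by rewrite ler_wpM2r// ler_pM2l.
have H2 : `|B (Y t) (d u - d t - (u - t) *: d')| <= D1 * `|Y t| * (e / M * r).
  apply: le_trans (BD _ _) _; by rewrite ler_wpM2l ?mulr_ge0 ?(ltW D10).
have H3 : `|B (Y u - Y t) (d u - d t)| <= D1 * (K1 * r) * (K2 * r).
  apply: le_trans (BD _ _) _; apply: ler_pM => //.
  - by rewrite mulr_ge0// ltW.
  - by rewrite ler_pM2l.
have H4 : D1 * (K1 * r) * (K2 * r) <= D1 * (K1 * K2) * (e / M * r).
  have -> : D1 * (K1 * r) * (K2 * r) = D1 * (K1 * K2) * (r * r) by ring.
  by apply: ler_wpM2l; [rewrite !mulr_ge0// ltW|exact: ler_wpM2r].
have H5 : e * r = D1 * (e / M * r) * `|d t| + D1 * `|Y t| * (e / M * r)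
   + D1 * (K1 * K2) * (e / M * r) + D1 * (e / M * r).
  transitivity (M * (e / M * r)); first by field; exact: lt0r_neq0.
  by rewrite /M; ring.
have H6 : 0 <= D1 * (e / M * r).
  by rewrite mulr_ge0 ?(ltW D10)// mulr_ge0// ltW.
rewrite H5.
apply: le_trans (ler_normD _ _) _.
apply: (@le_trans _ _ (D1 * (e / M * r) * `|d t| + D1 * `|Y t| * (e / M * r)
  + D1 * (K1 * K2) * (e / M * r))); last by lra.
apply: lerD; last exact: le_trans H4.
by apply: le_trans (ler_normD _ _) _; exact: lerD.
Qed.

Lemma has_deriv_expR (k t : R) : has_deriv (fun u => expR (k * u)) t (k * expR (k * t)).
Proof.
apply/has_derivP.
have h1 : is_derive t 1 (fun u : R => k * u) k.
  by apply/has_derivP; have := has_deriv_scale k (has_deriv_id t); rewrite mulr1.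
by rewrite mulrC; exact: (@is_derive1_comp _ expR (fun u : R => k * u)).
Qed.

End DerivativeRules.

(** * Comparison and the Gronwall inequality *)

Section AlmostEverywhere.
Variable R : realType.
Local Notation mu := (@lebesgue_measure R).

Lemma ae_mono (P Q : R -> Prop) : (forall t, P t -> Q t) ->
  {ae mu, forall t, P t} -> {ae mu, forall t, Q t}.
Proof. by move=> PQ; apply: negligibleS => t /= nQ Pt; exact/nQ/PQ. Qed.

Lemma ae_and (P Q : R -> Prop) : {ae mu, forall t, P t} ->
  {ae mu, forall t, Q t} -> {ae mu, forall t, P t /\ Q t}.
Proof.
move=> aP aQ; apply: negligibleS (negligibleU aP aQ) => t /= nPQ.
by apply: contrapT => /not_orP[/contrapT Pt /contrapT Qt]; exact: nPQ.
Qed.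

Lemma ae_neq (c : R) : {ae mu, forall t, t != c}.
Proof.
have h : mu.-negligible [set c].
  by apply/negligibleP => //; exact: lebesgue_measure_set1.
by apply: negligibleS h => t /= /negP; rewrite negbK => /eqP.
Qed.

End AlmostEverywhere.

Section Gronwall.
Variables (R : realType) (V : normedModType R) (L b : R) (q : R -> R).
Hypotheses (L0 : 0 < L).
Hypothesis qm : forall u v, 0 <= u -> u <= v -> v <= b -> q u <= q v.
Local Notation mu := (@lebesgue_measure R).
Local Notation E t := (expR (2 * L * t)).

(** The comparison function is [A / 2 * exp (2 L t) + q t], whose derivative is the
    assumed bound.  The factor [1 / 2], gained by taking the exponent [2 L], is the
    contraction behind both the Gronwall inequality and Picard iteration. *)
Lemma exp_comparison (A : R) (d : R -> V) : 0 <= A -> abs_continuous 0 b d ->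
  {ae mu, forall t, 0 < t < b -> exists (l : V) (c : R),
     [/\ has_deriv d t l, has_deriv q t c & `|l| <= L * (A * E t) + c]} ->
  forall t, 0 <= t <= b -> `|d t - d 0| <= A / 2 * (E t - 1) + (q t - q 0).
Proof.
move=> A0 acd dd t /andP[t0 tb].
pose m u := A / 2 * E u + q u.
have := @mean_value_ae R V d m 0 t t0 (abs_continuous_sub (lexx 0) tb acd).
have -> : m t - m 0 = A / 2 * (E t - 1) + (q t - q 0).
  by rewrite /m mulr0 expR0; ring.
apply.
- move=> u v u0 uv vt; apply: lerD; last by apply: qm => //; exact: le_trans tb.
  by rewrite ler_wpM2l ?divr_ge0// ler_expR ler_pM2l// mulr_gt0.
- apply: ae_mono dd => u + /andP[u0 ut].
  move=> []; first by rewrite u0 (lt_le_trans ut).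
  move=> l [c [dl qc lc]]; exists l, (A / 2 * (2 * L * E u) + c); split => //.
    by apply: has_derivD => //; apply: has_deriv_scale; exact: has_deriv_expR.
  by apply: le_trans lc _; rewrite lerD2r le_eqVlt; apply/orP; left; apply/eqP; field.
Qed.

(** Apply the comparison with [A] the maximum of [|d t| * exp (- 2 L t)]: it gives
    [A <= A / 2 + (q b - q 0)]. *)
Lemma gronwall (d : R -> V) : 0 <= b -> d 0 = 0 -> abs_continuous 0 b d ->
  {ae mu, forall t, 0 < t < b -> exists (l : V) (c : R),
     [/\ has_deriv d t l, has_deriv q t c & `|l| <= L * `|d t| + c]} ->
  forall t, 0 <= t <= b -> `|d t| <= 2 * (q b - q 0) * E t.
Proof.
move=> b0 d0 acd dd.
pose W u := `|(d \o clamp 0 b) u| * expR (- (2 * L) * u).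
have cW : continuous W.
  move=> u; apply: cvgM.
    apply: cvg_norm; exact: continuous_abs_clamp.
  apply: continuous_comp; last exact: continuous_expR.
  exact: mulrl_continuous.
have [t0 + Wt0] := @EVT_max R W 0 b b0 (continuous_subspaceT cW).
rewrite in_itv/= => /andP[t00 t0b].
have dW t : 0 <= t <= b -> `|d t| <= W t0 * E t.
  move=> t0b'; have := Wt0 t; rewrite in_itv/= => /(_ t0b').
  rewrite {1}/W/= clamp_id// mulNr expRN ler_pdivrMr ?expR_gt0//.
have W0 : 0 <= W t0 by rewrite /W mulr_ge0// expR_ge0.
have := @exp_comparison (W t0) d W0 acd.
move=> H.
have {}H : forall t, 0 <= t <= b -> `|d t - d 0| <= W t0 / 2 * (E t - 1) + (q t - q 0).
  apply: H; apply: ae_mono dd => t + t0b'; move=> /(_ t0b') [l [c [h1 h2 h3]]].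
  exists l, c; split => //; apply: le_trans h3 _; rewrite lerD2r ler_pM2l//.
  by apply: dW; case/andP: t0b' => *; rewrite !ltW.
have q0b : 0 <= q b - q 0 by rewrite subr_ge0; apply: qm.
have WE : W t0 <= 2 * (q b - q 0).
  have := H t0; rewrite t00 t0b d0 subr0 => /(_ isT) H0.
  have : `|d t0| = W t0 * E t0.
    by rewrite /W/= clamp_id ?t00// mulNr expRN divfK// lt0r_neq0// expR_gt0.
  move=> E0; rewrite E0 in H0.
  have E1 : 1 <= E t0 by rewrite -expR0 ler_expR !mulr_ge0// ltW.
  have H1 : q t0 - q 0 <= q b - q 0 by rewrite lerD2r; apply: qm.
  have H2 : (q b - q 0) * 1 <= (q b - q 0) * E t0 by rewrite ler_wpM2l.
  rewrite -(ler_pM2r (lt_le_trans ltr01 E1)).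
  nra.
move=> t ht; apply: le_trans (dW t ht) _.
by rewrite ler_pM2r// expR_gt0.
Qed.

End Gronwall.

(** * Norms, primitives and completeness of row vectors and pairs *)

Section MatrixNorm.
Variable R : realType.

Lemma mx_norm_le m n (M : 'M[R]_(m, n)) (c : R) : 0 <= c ->
  (forall i j, `|M i j| <= c) -> `|M| <= c.
Proof.
move=> c0 Mc; rewrite [leLHS]/Num.norm/= mx_normrE; apply/bigmax_leP.
by split=> // -[i j] _; exact: Mc.
Qed.

Lemma mx_entry_le m n (M : 'M[R]_(m, n)) i j : `|M i j| <= `|M|.
Proof.
by rewrite [leRHS]/Num.norm/= mx_normrE; apply/bigmax_geP; right; exists (i, j).
Qed.

Lemma mulmx_norm_le m n p (A : 'M[R]_(m, n)) (B : 'M[R]_(n, p)) :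
  `|A *m B| <= n%:R * `|A| * `|B|.
Proof.
apply: mx_norm_le => [|i j]; first by rewrite !mulr_ge0.
rewrite mxE; apply: le_trans (ler_norm_sum _ _ _) _.
apply: (@le_trans _ _ (\sum_(l < n) `|A| * `|B|)).
  by apply: ler_sum => l _; rewrite normrM ler_pM// mx_entry_le.
by rewrite sumr_const card_ord -mulrA mulr_natl.
Qed.

Lemma trmx_norm m n (A : 'M[R]_(m, n)) : `|A^T| = `|A|.
Proof.
apply/eqP; rewrite eq_le; apply/andP; split; apply: mx_norm_le => // i j.
  by rewrite mxE mx_entry_le.
by have := mx_entry_le A^T j i; rewrite mxE.
Qed.

End MatrixNorm.

Section Primitives.
Variable R : realType.

(** Stated as a property so that it passes from the line to row vectors and pairs
    componentwise. *)
Definition has_primitives (V : normedModType R) := forall (a b : R) (g : R -> V),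
  continuous g -> exists F : R -> V, forall t, a < t < b -> has_deriv F t (g t).

(** Completeness restricted to sequences with geometrically decreasing increments, with
    an explicit rate: this form passes to products without any filter argument. *)
Definition geometric_complete (V : normedModType R) := forall (C : R) (u : nat -> V),
  (forall m n, (m <= n)%N -> `|u n - u m| <= C / 2 ^+ m) ->
  exists l, forall n, `|u n - l| <= C / 2 ^+ n.

Lemma has_primitives_real : has_primitives R.
Proof.
move=> a b g cg; exists (fun x => \int[@lebesgue_measure R]_(t in `[a, x]) (g t))%R.
move=> t /andP[a_t tb].
have [] := @continuous_FTC1_closed R g a t b tb _ a_t (cg t).
  apply: continuous_compact_integrable; first exact: segment_compact.
  exact: continuous_subspaceT.
by move=> dF Fg; apply/has_derivP; apply: DeriveDef; [exact: dF|rewrite -derive1E].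
Qed.

(** The limit is the supremum of the lower bounds [u n - C / 2 ^+ n]. *)
Lemma geometric_complete_real : geometric_complete R.
Proof.
move=> C u uC.
have C0 : 0 <= C by have := uC 0%N 0%N (leqnn _); rewrite subrr normr0 expr0 divr1.
have Cn n : 0 <= C / 2 ^+ n by rewrite divr_ge0// exprn_ge0.
have H m n : u m - C / 2 ^+ m <= u n + C / 2 ^+ n.
  have := Cn n; have := Cn m.
  case: (leqP m n) => [mn|/ltnW mn]; have := uC _ _ mn.
    by rewrite ler_norml => /andP[]; lra.
  by rewrite ler_norml => /andP[]; lra.
pose S := range (fun m => u m - C / 2 ^+ m).
have S0 : S !=set0 by exists (u 0%N - C / 2 ^+ 0), 0%N.
exists (sup S) => n.
have h1 : u n - C / 2 ^+ n <= sup S.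
  apply: ub_le_sup; last by exists n.
  by exists (u 0%N + C / 2 ^+ 0) => _ [m _ <-].
have h2 : sup S <= u n + C / 2 ^+ n.
  by apply: ge_sup => // _ [m _ <-].
by rewrite ler_norml; apply/andP; split; lra.
Qed.

Lemma has_primitives_rV n : has_primitives 'rV[R]_n.
Proof.
move=> a b g cg.
have ci (i : 'I_n) : continuous (fun t => g t 0 i).
  move=> t; apply: (@continuous_comp _ _ _ g (fun M => M 0 i)); first exact: cg.
  exact: coord_continuous.
have /choice[F HF] := fun i => has_primitives_real a b (ci i).
exists (fun t => \row_i F i t) => t tab e e0.
have : \forall u \near t, forall i : 'I_n, `|F i u - F i t - (u - t) *: g t 0 i| <= e * `|u - t|.
  apply: (@filter_forall R 'I_n
    (fun i u => `|F i u - F i t - (u - t) *: g t 0 i| <= e * `|u - t|) (nbhs t) _) => i.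
  exact: HF.
apply: filterS => u Hu; apply: mx_norm_le; first by rewrite mulr_ge0// ltW.
by move=> i j; rewrite !ord1 !mxE; exact: Hu.
Qed.

Lemma geometric_complete_rV n : geometric_complete 'rV[R]_n.
Proof.
move=> C u uC.
have C0 : 0 <= C.
  by have := uC 0%N 0%N (leqnn _); rewrite expr0 divr1; apply: le_trans.
have H (i : 'I_n) : exists l, forall m, `|u m 0 i - l| <= C / 2 ^+ m.
  apply: geometric_complete_real => p q pq; apply: (le_trans _ (uC _ _ pq)).
  by have := mx_entry_le (u q - u p) 0 i; rewrite !mxE.
have [l Hl] := choice H.
exists (\row_i l i) => m; apply: mx_norm_le => [|i j].
  by rewrite divr_ge0// exprn_ge0.
by rewrite !ord1 !mxE.
Qed.

Lemma pair_norm_le (V W : normedModType R) (z : V * W) (c : R) :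
  `|z.1| <= c -> `|z.2| <= c -> `|z| <= c.
Proof. by move=> h1 h2; rewrite [leLHS]/Num.norm/= ge_max h1. Qed.

Lemma pair_fst_le (V W : normedModType R) (z : V * W) : `|z.1| <= `|z|.
Proof. by rewrite [leRHS]/Num.norm/= le_max lexx. Qed.

Lemma pair_snd_le (V W : normedModType R) (z : V * W) : `|z.2| <= `|z|.
Proof. by rewrite [leRHS]/Num.norm/= le_max lexx orbT. Qed.

Lemma has_primitives_pair (V W : normedModType R) :
  has_primitives V -> has_primitives W -> has_primitives (V * W)%type.
Proof.
move=> pV pW a b g cg.
have [|F1 H1] := pV a b (fst \o g).
  by move=> t; apply: continuous_comp; [exact: cg|exact: cvg_fst].
have [|F2 H2] := pW a b (snd \o g).
  by move=> t; apply: continuous_comp; [exact: cg|exact: cvg_snd].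
exists (fun t => (F1 t, F2 t)) => t tab.
by rewrite (surjective_pairing (g t)); apply: has_deriv_pair; [exact: H1|exact: H2].
Qed.

Lemma geometric_complete_pair (V W : normedModType R) :
  geometric_complete V -> geometric_complete W -> geometric_complete (V * W)%type.
Proof.
move=> cV cW C u uC.
have [|l1 H1] := cV C (fst \o u).
  by move=> m n mn; apply: (le_trans _ (uC _ _ mn)); exact: (pair_fst_le (u n - u m)).
have [|l2 H2] := cW C (snd \o u).
  by move=> m n mn; apply: (le_trans _ (uC _ _ mn)); exact: (pair_snd_le (u n - u m)).
by exists (l1, l2) => n; apply: pair_norm_le; [exact: H1|exact: H2].
Qed.

End Primitives.

(** * Picard iteration for a switched system *)

Section Locate.
Variable R : realType.

Lemma locate (N : nat) (s : nat -> R) (t : R) :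
  s 0%N < t < s N -> (forall i, (i <= N)%N -> t != s i) ->
  exists2 i, (i < N)%N & s i < t < s i.+1.
Proof.
elim: N => [|N IH] /andP[t0 tN] ts.
  by have := lt_trans t0 tN; rewrite ltxx.
case: (ltgtP t (s N)) => h.
- have [||i iN ti] := IH; first by rewrite t0.
    by move=> i iN; apply: ts; exact: leqW.
  by exists i => //; exact: ltnW.
- by exists N => //; rewrite h.
- by have := ts N (leqnSn _); rewrite h eqxx.
Qed.

Lemma ae_locate (N : nat) (s : nat -> R) : {ae @lebesgue_measure R, forall t,
  s 0%N < t < s N -> exists2 i, (i < N)%N & s i < t < s i.+1}.
Proof.
apply: (ae_mono _ (ae_foralln (fun n => ae_neq (s n)))) => t ts st.
by apply: locate.
Qed.

End Locate.

(** Curves known only through their derivative are not yet known to be absolutely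
    continuous; here the derivative exists everywhere and real induction applies directly. *)
Lemma lipschitz_of_deriv (R : realType) (V : normedModType R) (g : R -> V)
    (a b K : R) : a <= b ->
  (forall t, a <= t <= b -> exists2 l, has_deriv g t l & `|l| <= K) ->
  `|g b - g a| <= K * (b - a).
Proof.
move=> ab gK; apply/ler_addgt0Pr => e e0.
pose e1 := e / (b - a + 1).
have e10 : 0 < e1 by rewrite divr_gt0//; lra.
suff : `|g b - g a| <= (K + e1) * (b - a).
  have : e1 * (b - a) <= e by rewrite /e1 -mulrA ler_piMr ?(ltW e0)// mulrC ler_pdivrMr; lra.
  lra.
apply: (@cousin R (fun u v => `|g v - g u| <= (K + e1) * (v - u))) => //.
- move=> u v w _ _ _ _ h1 h2.
  have -> : g w - g u = (g w - g v) + (g v - g u) by rewrite addrA subrK.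
  by apply: le_trans (ler_normD _ _) _; lra.
- move=> t tab; have [l gl lK] := gK t tab.
  have [d d0 Hd] := has_deriv_straddle gl e10.
  exists d => // u v _ ut tv _ uvd.
  rewrite -[g v - g u](subrK ((v - u) *: l)); apply: le_trans (ler_normD _ _) _.
  have := Hd u v ut tv uvd; rewrite normrZ ger0_norm; last by lra.
  have : (v - u) * `|l| <= (v - u) * K by rewrite ler_wpM2l//; lra.
  lra.
Qed.

Lemma has_deriv_sum (R : realType) (V : normedModType R) n (h : 'I_n -> R -> V)
    (l : 'I_n -> V) t : (forall i, has_deriv (h i) t (l i)) ->
  has_deriv (fun u => \sum_i h i u) t (\sum_i l i).
Proof.
move=> hl; apply/has_derivP.
have -> : (fun u => \sum_i h i u) = \sum_i h i by apply/funext => u; rewrite fct_sumE.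
by apply: is_derive_sum => i; exact/has_derivP.
Qed.

Section Picard.
Variables (R : realType) (V : normedModType R).
Hypotheses (Vprim : has_primitives V) (Vcomp : geometric_complete V).
Variables (k : nat) (T : R) (s lo hi : nat -> R) (G : nat -> V -> R -> V).
Variables (zb : R -> V) (rho L K : R).
Hypotheses (L0 : 0 < L) (K0 : 0 <= K).
Hypotheses (s0 : s 0%N = 0) (sT : s k.+1 = T).
Hypothesis smono : forall i, (i <= k)%N -> s i < s i.+1.
Hypothesis slo : forall i, (i <= k)%N -> lo i <= s i.
Hypothesis shi : forall i, (i <= k)%N -> s i.+1 <= hi i.
Hypothesis GL : forall i t c c', (i <= k)%N -> lo i <= t <= hi i ->
  `|c - zb t| <= rho -> `|c' - zb t| <= rho ->
  `|G i c t - G i c' t| <= L * `|c - c'|.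
Hypothesis GK : forall i t c, (i <= k)%N -> lo i <= t <= hi i ->
  `|c - zb t| <= rho -> `|G i c t| <= K.
Hypothesis GC : forall i (zeta : R -> V) a b, (i <= k)%N ->
  lo i <= a -> a <= b -> b <= hi i -> continuous (zeta \o clamp a b) ->
  (forall t, a <= t <= b -> `|zeta t - zb t| <= rho) ->
  continuous (fun t => G i (zeta (clamp a b t)) (clamp a b t)).
Local Notation mu := (@lebesgue_measure R).
Local Notation E t := (expR (2 * L * t)).

Lemma switching_le i j : (i <= j)%N -> (j <= k.+1)%N -> s i <= s j.
Proof.
elim: j => [|j IH]; first by rewrite leqn0 => /eqP->.
rewrite leq_eqVlt => /orP[/eqP-> //|]; rewrite ltnS => ij jk.
by rewrite (le_trans (IH ij (ltnW jk)))// ltW// smono.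
Qed.

Lemma horizon_ge0 : 0 <= T. Proof. by rewrite -s0 -sT switching_le. Qed.

Definition admissible (zeta : R -> V) := continuous (zeta \o clamp 0 T) /\
  forall t, 0 <= t <= T -> `|zeta t - zb t| <= rho.

Lemma phase_in_window i t : (i <= k)%N -> s i < t < s i.+1 -> lo i <= t <= hi i.
Proof.
move=> ik /andP[h1 h2]; rewrite (le_trans (slo ik) (ltW h1)).
by rewrite (le_trans (ltW h2) (shi ik)).
Qed.

Lemma phase_in_horizon i t : (i <= k)%N -> s i < t < s i.+1 -> 0 < t < T.
Proof.
move=> ik /andP[h1 h2]; have a := switching_le (leq0n i) (leqW ik).
have b := switching_le (ik : (i.+1 <= k.+1)%N) (leqnn _).
by rewrite s0 in a; rewrite sT in b; rewrite (le_lt_trans a h1) (lt_le_trans h2 b).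
Qed.

(** A primitive of the piecewise continuous curve [G i (zeta t) t].  On each phase
    the argument is clamped to the phase, which gives a continuous curve with a primitive
    [Phi i]; the sum of the increments of the [Phi i], clamped again, is the integral
    across all phases. *)
Lemma picard_step (z0 : V) (zeta : R -> V) : admissible zeta ->
  exists F : R -> V, [/\ F 0 = z0,
    forall u v, 0 <= u -> u <= v -> v <= T ->
      `|F v - F u| <= k.+1%:R * K * (v - u) &
    forall i t, (i <= k)%N -> s i < t < s i.+1 -> has_deriv F t (G i (zeta t) t)].
Proof.
move=> [czeta tz].
pose cl (i : 'I_k.+1) := clamp (s i) (s i.+1).
have ik (i : 'I_k.+1) : (i <= k)%N by rewrite -ltnS.
have si0 (i : 'I_k.+1) : 0 <= s i by rewrite -s0; apply: switching_le => //; exact: leqW.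
have siT (i : 'I_k.+1) : s i.+1 <= T by rewrite -sT; apply: switching_le => //; exact: ltn_ord.
have sii (i : 'I_k.+1) : s i <= s i.+1 by rewrite ltW// smono.
pose g (i : 'I_k.+1) t := G i (zeta (cl i t)) (cl i t).
have clz (i : 'I_k.+1) t : s i <= cl i t <= s i.+1 by exact: clamp_in.
have cg i : continuous (g i).
  apply: GC => //; [exact: slo|exact: shi| |].
    have -> : zeta \o clamp (s i) (s i.+1) = (zeta \o clamp 0 T) \o cl i.
      apply/funext => t /=; rewrite [clamp 0 T _]clamp_id//.
      by have /andP[h1 h2] := clz i t; rewrite (le_trans (si0 i))// (le_trans h2).
    by move=> t; apply: continuous_comp; [exact: continuous_clamp|exact: czeta].
  by move=> t /andP[h1 h2]; apply: tz; rewrite (le_trans (si0 i))// (le_trans h2).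
have gK i t : `|g i t| <= K.
  have /andP[h1 h2] := clz i t.
  apply: GK => //; first by rewrite (le_trans _ h1) ?slo// (le_trans h2)// shi.
  by apply: tz; rewrite (le_trans (si0 i))// (le_trans h2).
have [Phi HPhi] := choice (fun i => Vprim (-1) (T + 1) (cg i)).
pose h (i : 'I_k.+1) t := Phi i (cl i t) - Phi i (s i).
exists (fun t => z0 + \sum_i h i t); split.
- rewrite big1 ?addr0// => i _; rewrite /h /cl clamp_left ?subrr//; exact: si0.
- move=> u v u0 uv vT; rewrite opprD addrACA subrr add0r -sumrB.
  apply: le_trans (ler_norm_sum _ _ _) _.
  apply: (@le_trans _ _ (\sum_(i < k.+1) K * (v - u))); last first.
    by rewrite sumr_const card_ord -mulrA mulr_natl.
  apply: ler_sum => i _; rewrite /h opprB addrA subrK.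
  apply: (@le_trans _ _ (K * (cl i v - cl i u))); last first.
    by rewrite ler_wpM2l// clamp_lip.
  apply: lipschitz_of_deriv; first exact: clamp_mono.
  move=> t /andP[h1 h2]; exists (g i t) => //; apply: HPhi.
  have /andP[h3 _] := clz i u; have /andP[_ h4] := clz i v.
  have := si0 i; have := siT i; lra.
- move=> i t ik' /andP[h1 h2]; pose i0 : 'I_k.+1 := Ordinal (ik' : (i < k.+1)%N).
  have tnear : \forall u \near t, s i < u < s i.+1.
    by near=> u; apply/andP; split; near: u; [exact: lt_nbhsr|exact: lt_nbhsl].
  have hd (j : 'I_k.+1) : has_deriv (h j) t (if j == i0 then G i (zeta t) t else 0).
    case: eqP => [->|ji].
      apply: (@has_deriv_near _ _ (fun u => Phi i0 u - Phi i0 (s i0))).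
        apply: filterS tnear => u /andP[a b]; rewrite /h /cl clamp_id//=.
        by rewrite !ltW.
      have -> : G i (zeta t) t = g i0 t.
        by rewrite /g /cl/= clamp_id// !ltW.
      rewrite -[g i0 t]subr0; apply: has_derivB; last exact: has_deriv_cst.
      apply: HPhi; have := si0 i0; have := siT i0; rewrite /=; lra.
    have [ltji|] := ltnP j i.
      apply: (@has_deriv_near _ _ (fun u => Phi j (s j.+1) - Phi j (s j)));
        last exact: has_deriv_cst.
      apply: filterS tnear => u /andP[a b]; rewrite /h /cl clamp_right//.
      by apply: le_trans (ltW a); apply: switching_le => //; exact: leqW.
    rewrite leq_eqVlt => /orP[/eqP ij|ltij].
      by exfalso; apply: ji; apply/val_inj.
    apply: (@has_deriv_near _ _ (fun u => Phi j (s j) - Phi j (s j))); last exact: has_deriv_cst.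
    apply: filterS tnear => u /andP[a b]; rewrite /h /cl clamp_left//.
    by apply: le_trans (ltW b) _; apply: switching_le => //; exact: leqW.
  have := has_deriv_sum hd; rewrite -big_mkcond big_pred1_eq => H.
  rewrite -[G i (zeta t) t]add0r; apply: has_derivD => //; exact: has_deriv_cst.
Unshelve. all: by end_near.
Qed.

Lemma ae_switch : {ae mu, forall t, 0 < t < T ->
  exists2 i, (i <= k)%N & s i < t < s i.+1}.
Proof. by have := @ae_locate R k.+1 s; rewrite s0 sT. Qed.

Variable q : R -> R.
Hypothesis qm : forall u v, 0 <= u -> u <= v -> v <= T -> q u <= q v.
Hypothesis aczb : abs_continuous 0 T zb.
Hypothesis zbq : {ae mu, forall t i, (i <= k)%N -> s i < t < s i.+1 ->
  exists (l : V) (c : R),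
     [/\ has_deriv zb t l, has_deriv q t c & `|G i (zb t) t - l| <= c]}.
Local Notation A := (2 * (q T - q 0)).
Hypothesis Arho : A * E T <= rho.

(** Picard iteration started at the approximate solution [zb].  By [exp_comparison], in the
    norm weighted by [exp (- 2 L t)] the iterates stay within [A] of [zb], hence in the
    tube, and each step halves distances. *)
Theorem picard_solution : exists z : R -> V, [/\ z 0 = zb 0,
  abs_continuous 0 T z &
  forall i t, (i <= k)%N -> s i < t < s i.+1 -> has_deriv z t (G i (z t) t)].
Proof.
have Tge0 := horizon_ge0.
have A0 : 0 <= A by rewrite mulr_ge0// subr_ge0 qm.
have ET t : 0 <= t <= T -> E t <= E T.
  by move=> /andP[_ tT]; rewrite ler_expR ler_pM2l// mulr_gt0.
have Arho' t : 0 <= t <= T -> A * E t <= rho.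
  by move=> tT; apply: le_trans Arho; rewrite ler_wpM2l// ET.
have rho0 : 0 <= rho by apply: le_trans Arho; rewrite mulr_ge0// expR_ge0.
have [op Hop] : exists op : (R -> V) -> (R -> V), forall zeta, admissible zeta ->
  [/\ op zeta 0 = zb 0,
    forall u v, 0 <= u -> u <= v -> v <= T ->
      `|op zeta v - op zeta u| <= k.+1%:R * K * (v - u) &
    forall i t, (i <= k)%N -> s i < t < s i.+1 ->
      has_deriv (op zeta) t (G i (zeta t) t)].
  have : forall zeta, exists F : R -> V, admissible zeta -> [/\ F 0 = zb 0,
    forall u v, 0 <= u -> u <= v -> v <= T ->
      `|F v - F u| <= k.+1%:R * K * (v - u) &
    forall i t, (i <= k)%N -> s i < t < s i.+1 -> has_deriv F t (G i (zeta t) t)].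
    move=> zeta; have [az|naz] := pselect (admissible zeta); last by exists zb.
    by have [F HF] := picard_step (zb 0) az; exists F.
  by move/choice => [op Hop]; exists op.
(* the continuity needed of an iterate follows from a Lipschitz bound *)
have admW zeta (B : R) : (forall u v, 0 <= u -> u <= v -> v <= T ->
      `|zeta v - zeta u| <= B * (v - u)) ->
    (forall t, 0 <= t <= T -> `|zeta t - zb t| <= rho) -> admissible zeta.
  move=> lz tz; split=> //; apply: continuous_abs_clamp => //.
  exact: lipschitz_abs_continuous lz.
(* one Picard step contracts the weighted sup norm by a factor 1/2 *)
have contract z1 z2 (B : R) : 0 <= B -> admissible z1 -> admissible z2 ->
    (forall t, 0 <= t <= T -> `|z1 t - z2 t| <= B * E t) ->
    forall t, 0 <= t <= T -> `|op z1 t - op z2 t| <= B / 2 * E t.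
  move=> B0 a1 a2 z12 t tT.
  have [r10 lz1 d1] := Hop _ a1; have [r20 lz2 d2] := Hop _ a2.
  have := @exp_comparison R V L T (fun=> 0) L0 (fun _ _ _ _ _ => lexx 0) B
    (fun t => op z1 t - op z2 t) B0.
  move=> H; have {}H := H _ _ t tT.
  have : `|op z1 t - op z2 t - (op z1 0 - op z2 0)| <= B / 2 * (E t - 1) + (0 - 0).
    apply: H.
      apply: (@abs_continuous_dom _ _ _ _ _ (op z1) (op z2) _ _ 1).
      - by move=> u v _ _ _; rewrite mul1r subrACA; exact: ler_normB.
      - exact: lipschitz_abs_continuous lz1.
      - exact: lipschitz_abs_continuous lz2.
    apply: (ae_mono _ ae_switch) => u + uT => /(_ uT)[i ik ui].
    have uT' : 0 <= u <= T by case/andP: uT => *; rewrite !ltW.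
    exists (G i (z1 u) u - G i (z2 u) u), 0; split.
    - by apply: has_derivB; [exact: d1|exact: d2].
    - exact: has_deriv_cst.
    - rewrite addr0; apply: le_trans (GL ik (phase_in_window ik ui) _ _) _.
      + by case: a1 => _; apply.
      + by case: a2 => _; apply.
      + by rewrite ler_pM2l// z12.
  rewrite r10 r20 subrr subr0; have : 0 <= B / 2 by rewrite divr_ge0.
  move=> h1 h2; lra.
have admzb : admissible zb.
  by split; [exact: continuous_abs_clamp|move=> t _; rewrite subrr normr0].
(* the defect of [zb] enters through [q], and [A] absorbs it *)
have first_step zeta : admissible zeta ->
    (forall t, 0 <= t <= T -> `|zeta t - zb t| <= A * E t) ->
    forall t, 0 <= t <= T -> `|op zeta t - zb t| <= A * E t.
  move=> az zA t tT; have [r0 lo_ d1] := Hop _ az.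
  have := @exp_comparison R V L T q L0 qm A (fun t => op zeta t - zb t) A0.
  move=> H; have {}H := H _ _ t tT.
  have : `|op zeta t - zb t - (op zeta 0 - zb 0)| <= A / 2 * (E t - 1) + (q t - q 0).
    apply: H.
      apply: (@abs_continuous_dom _ _ _ _ _ (op zeta) zb _ _ 1).
      - by move=> u v _ _ _; rewrite mul1r subrACA; exact: ler_normB.
      - exact: lipschitz_abs_continuous lo_.
      - exact: aczb.
    apply: (ae_mono _ (ae_and ae_switch zbq)) => u [+ zbu] uT => /(_ uT)[i ik ui].
    have uT' : 0 <= u <= T by case/andP: uT => *; rewrite !ltW.
    have [l [c [dl dc lc]]] := zbu i ik ui.
    exists (G i (zeta u) u - l), c; split => //.
    - by apply: has_derivB => //; exact: d1.
    - have -> : G i (zeta u) u - l = (G i (zeta u) u - G i (zb u) u) + (G i (zb u) u - l).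
        by rewrite addrA subrK.
      apply: le_trans (ler_normD _ _) _; apply: lerD => //.
      apply: le_trans (GL ik (phase_in_window ik ui) _ _) _.
      + by case: az => _; apply.
      + by rewrite subrr normr0.
      + by rewrite ler_pM2l// zA.
  rewrite r0 subrr subr0.
  have h1 : q t <= q T by case/andP: tT => *; apply: qm.
  have h2 : 0 <= (q T - q 0) * E t by rewrite mulr_ge0 ?expR_ge0// subr_ge0 qm.
  move=> h; lra.
pose z n := iter n op zb.
have zA n : admissible (z n) /\ forall t, 0 <= t <= T -> `|z n t - zb t| <= A * E t.
  elim: n => [|n [an IH]].
    by split=> // t _; rewrite /z/= subrr normr0 mulr_ge0// expR_ge0.
  have H := first_step _ an IH; split=> //.
  have [_ lz _] := Hop _ an.
  by apply: admW lz _ => t tT; apply: le_trans (H t tT) (Arho' t tT).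
have zd n t : 0 <= t <= T -> `|z n.+1 t - z n t| <= A / 2 ^+ n * E t.
  elim: n t => [|n IH] t tT; first by rewrite expr0 divr1; exact: (zA 1%N).2.
  rewrite exprSr invfM mulrA; apply: contract => //.
  - by rewrite divr_ge0// exprn_ge0.
  - exact: (zA n.+1).1.
  - exact: (zA n).1.
pose C := 2 * A * E T.
have C0 : 0 <= C by rewrite mulr_ge0 ?expR_ge0// mulr_ge0.
have zC t : 0 <= t <= T -> forall m n, (m <= n)%N -> `|z n t - z m t| <= C / 2 ^+ m.
  move=> tT m n mn.
  have : `|z n t - z m t| <= C / 2 ^+ m - C / 2 ^+ n.
    rewrite -(subnK mn); elim: (n - m)%N => [|p IH]; first by rewrite add0n !subrr normr0.
    rewrite addSn; set N := (p + m)%N.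
    have -> : z N.+1 t - z m t = (z N.+1 t - z N t) + (z N t - z m t) by rewrite addrA subrK.
    apply: le_trans (ler_normD _ _) _.
    have h1 : A / 2 ^+ N * E t <= A / 2 ^+ N * E T.
      by rewrite ler_wpM2l ?ET// divr_ge0// exprn_ge0.
    have h2 := zd N t tT.
    have h3 : C / 2 ^+ N.+1 = A / 2 ^+ N * E T.
      by rewrite /C exprS; field; rewrite expf_neq0.
    have h4 : C / 2 ^+ N = 2 * (A / 2 ^+ N * E T) by rewrite /C; ring.
    rewrite -/N in IH; lra.
  have : 0 <= C / 2 ^+ n by rewrite divr_ge0 ?exprn_ge0.
  lra.
have [zl Hzl] : exists zl : R -> V, forall t, 0 <= t <= T -> forall n,
    `|z n t - zl t| <= C / 2 ^+ n.
  have : forall t, exists l : V, 0 <= t <= T -> forall n, `|z n t - l| <= C / 2 ^+ n.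
    move=> t; have [tT|nt] := boolP (0 <= t <= T); last by exists 0.
    have [|l Hl] := @Vcomp C (fun n => z n t); first exact: zC.
    by exists l.
  by move=> /choice[zl Hl]; exists zl.
have small (B e : R) : 0 <= B -> (forall n, e <= B / 2 ^+ n) -> e <= 0.
  move=> B0 He; rewrite leNgt; apply/negP => e0.
  have h := archi_boundP (divr_ge0 B0 (ltW e0)).
  have := He (Num.bound (B / e)); rewrite ler_pdivlMr ?exprn_gt0// leNgt => /negP; apply.
  rewrite mulrC -ltr_pdivrMr//; apply: lt_trans h _.
  by rewrite -natrX ltr_nat ltn_expl.
have azl : admissible zl.
  apply: (admW zl (k.+1%:R * K)) => [u v u0 uv vT|t tT].
    have uT : 0 <= u <= T by rewrite u0 (le_trans uv).
    have vT' : 0 <= v <= T by rewrite vT (le_trans u0).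
    rewrite -subr_le0; apply: (small C) => // n.
    have h1 := Hzl u uT n.+2; have h2 := Hzl v vT' n.+2.
    have [_ lz _] := Hop _ (zA n.+1).1.
    have h3 : `|z n.+2 v - z n.+2 u| <= k.+1%:R * K * (v - u) := lz u v u0 uv vT.
    have h4 : `|zl v - zl u| <= `|z n.+2 v - z n.+2 u| + (`|z n.+2 v - zl v| + `|z n.+2 u - zl u|).
      have -> : zl v - zl u = (z n.+2 v - z n.+2 u) - ((z n.+2 v - zl v) - (z n.+2 u - zl u)).
        by rewrite (subrACA (z n.+2 v) (zl v)) subKr.
      apply: le_trans (ler_normB _ _) _; rewrite lerD2l; exact: ler_normB.
    have h5 : C / 2 ^+ n.+2 = (C / 2 ^+ n) / 4.
      by rewrite !exprS; field; rewrite expf_neq0.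
    rewrite h5 in h1 h2; move: h4 h3 h1 h2; rewrite -/(z _).
    have := divr_ge0 C0 (exprn_ge0 n (ler0n R 2)); lra.
  rewrite -subr_le0; apply: (small C) => // n.
  have h1 := Hzl t tT n; have h2 := le_trans ((zA n).2 t tT) (Arho' t tT).
  have -> : zl t - zb t = (z n t - zb t) - (z n t - zl t) by rewrite [RHS]subrACA subrr sub0r opprB.
  have := ler_normB (z n t - zb t) (z n t - zl t); lra.
(* the limit agrees with its own Picard iterate, which has the required derivative *)
have fixed t : 0 <= t <= T -> op zl t = zl t.
  move=> tT; apply/eqP; rewrite -subr_eq0 -normr_le0.
  apply: (small (C * (E T + 1))) => [|n].
    by rewrite mulr_ge0// addr_ge0// expR_ge0.
  have Cn : 0 <= C / 2 ^+ n by rewrite divr_ge0 ?exprn_ge0.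
  have h1 : `|op zl t - op (z n) t| <= C / 2 ^+ n / 2 * E t.
    apply: contract => //; first exact: (zA n).1.
    move=> u uT; rewrite distrC; apply: le_trans (Hzl u uT n) _.
    rewrite ler_peMr//; have /andP[u0 _] := uT.
    by rewrite -expR0 ler_expR !mulr_ge0// ltW.
  have h2 := Hzl t tT n.+1.
  have h3 : op zl t - zl t = (op zl t - op (z n) t) + (z n.+1 t - zl t) by rewrite addrA subrK.
  have h4 := ler_normD (op zl t - op (z n) t) (z n.+1 t - zl t).
  have h5 : C / 2 ^+ n * E t <= C / 2 ^+ n * E T by rewrite ler_wpM2l// ET.
  have h6 : 0 <= C / 2 ^+ n * E T by rewrite mulr_ge0// expR_ge0.
  have h7 : C / 2 ^+ n.+1 = C / 2 ^+ n / 2.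
    by rewrite exprS; field; rewrite expf_neq0.
  rewrite h3; apply: le_trans h4 _; rewrite h7 in h2.
  have -> : C * (E T + 1) / 2 ^+ n = C / 2 ^+ n * E T + C / 2 ^+ n by ring.
  lra.
have [r0 lo_ d1] := Hop _ azl.
exists (op zl); split => //; first exact: lipschitz_abs_continuous lo_.
move=> i t ik ti; rewrite fixed; first exact: d1.
by have /andP[h1 h2] := phase_in_horizon ik ti; rewrite !ltW.
Qed.

End Picard.

(** * Estimates of the field in a tube *)

Section Tube.
Variable R : realType.

Lemma scale_split (W : lmodType R) (a b l : W) (k : R) :
  a - k *: b + k *: (b - l) = a - k *: l.
Proof. by rewrite scalerBr addrA subrK. Qed.

(** Mean value inequality along a segment of [A], by real induction: difference quotients
    are taken inside [A], so the endpoints need no special treatment. *)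
Lemma cont_diff_segment (V W : normedModType R) (A : set V) (g : V -> W)
    (dg : V -> {linear V -> W}) (z v : V) (l : W) (C : R) :
  cont_diff_on A g dg ->
  (forall r : R, 0 <= r <= 1 -> A (z + r *: v)) ->
  (forall r : R, 0 <= r <= 1 -> `|dg (z + r *: v) v - l| <= C) ->
  `|g (z + v) - g z - l| <= C.
Proof.
move=> [gdg _] Av dC; apply/ler_addgt0Pr => e e0.
pose h r := g (z + r *: v) - r *: l.
have -> : g (z + v) - g z - l = h 1 - h 0.
  by rewrite /h !scale1r !scale0r addr0 subr0 addrAC.
rewrite -[C + e]mulr1 -[X in _ * X]subr0.
apply: (@cousin R (fun u w => `|h w - h u| <= (C + e) * (w - u))) => //.
- move=> u w y _ _ _ _ h1 h2.
  have -> : h y - h u = (h y - h w) + (h w - h u) by rewrite addrA subrK.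
  by apply: le_trans (ler_normD _ _) _; lra.
- move=> t t01.
  pose e1 := e / (`|v| + 1).
  have v1 : 0 < `|v| + 1 by rewrite ltr_wpDl.
  have e10 : 0 < e1 by rewrite divr_gt0.
  have /nbhs_ballP[d /= d0 Hd] := gdg _ (Av t t01) e1 e10.
  have K w : 0 <= w <= 1 -> `|w - t| < d / (`|v| + 1) -> `|h w - h t| <= (C + e) * `|w - t|.
    move=> w01 wt.
    have E : (z + w *: v) - (z + t *: v) = (w - t) *: v.
      by rewrite opprD addrACA subrr add0r -scalerBl.
    have := Hd (z + w *: v); rewrite -ball_normE /= -opprB normrN E => /(_ _ (Av w w01)).
    rewrite normrZ => H; have {}H := H _.
    have wtd : `|w - t| * `|v| < d.
      rewrite ltr_pdivlMr// in wt; apply: le_lt_trans wt.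
      by rewrite ler_wpM2l// lerDl.
    have {}H := H wtd; rewrite linearZ in H.
    have -> : h w - h t = (g (z + w *: v) - g (z + t *: v) - (w - t) *: dg (z + t *: v) v)
       + (w - t) *: (dg (z + t *: v) v - l).
      rewrite scale_split /h subrACA; congr (_ - _).
      by rewrite scalerBl.
    apply: le_trans (ler_normD _ _) _; rewrite normrZ.
    have h1 : e1 * (`|w - t| * `|v|) <= e * `|w - t|.
      rewrite mulrCA mulrC ler_wpM2r// /e1 -mulrA ler_piMr ?(ltW e0)//.
      by rewrite mulrC ler_pdivrMr// mul1r lerDl.
    have h2 : `|w - t| * `|dg (z + t *: v) v - l| <= `|w - t| * C by rewrite ler_wpM2l// dC.
    by apply: le_trans (lerD (le_trans H h1) h2) _; rewrite [leRHS]mulrDl addrC (mulrC C).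
  exists (d / (`|v| + 1)); first by rewrite divr_gt0.
  move=> u w u0 ut tw w1 uw.
  have /andP[t0 t1] := t01.
  have Kw : `|h w - h t| <= (C + e) * (w - t).
    rewrite -[X in _ * X](@ger0_norm _ (w - t)) ?subr_ge0//; apply: K.
      by rewrite w1 (le_trans t0).
    by rewrite ger0_norm ?subr_ge0//; lra.
  have Ku : `|h u - h t| <= (C + e) * (t - u).
    rewrite -[X in _ * X](@ger0_norm _ (t - u)) ?subr_ge0// (distrC t u); apply: K.
      by rewrite u0 (le_trans ut).
    by rewrite distrC ger0_norm ?subr_ge0//; lra.
  have -> : h w - h u = (h w - h t) - (h u - h t) by rewrite (opprB (h u)) subrKA.
  by apply: le_trans (ler_normB _ _) _; lra.
Qed.

Lemma continuous_pair (U W : topologicalType) (F : R -> U) (H : R -> W) :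
  continuous F -> continuous H -> continuous (fun t => (F t, H t)).
Proof. by move=> cF cH t; exact: (cvg_pair (cF t) (cH t)). Qed.

(** A curve with values in [A] only sees the topology induced on [A]. *)
Lemma within_continuous_comp (U W : topologicalType) (A : set U) (F : U -> W)
    (c : R -> U) : {within A, continuous F} -> continuous c ->
  (forall t, A (c t)) -> continuous (F \o c).
Proof.
move=> /subspace_continuousP cF cc Ac t N /= NF.
have := cF (c t) (Ac t) N NF => /= H.
have H2 : nbhs t (fun u => A (c u) -> N (F (c u))) := cc t _ H.
have : nbhs t (fun u => N (F (c u))) by apply: filterS H2 => u; apply; exact: Ac.
exact: id.
Qed.

Lemma continuous_bounded (W : normedModType R) (F : R -> W) (a b : R) :
  continuous F -> exists2 M : R, 0 <= M & forall t, a <= t <= b -> `|F t| <= M.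
Proof.
move=> cF; have [ab|ba] := leP a b; last first.
  by exists 0 => // t /andP[h1 h2]; have := le_lt_trans (le_trans h1 h2) ba; rewrite ltxx.
have cN : continuous (fun t => `|F t|) by move=> t; apply: cvg_norm; exact: cF.
have [c _ Hc] := @EVT_max R (fun t => `|F t|) a b ab (continuous_subspaceT cN).
by exists `|F c| => // t tab; apply: Hc; rewrite in_itv.
Qed.

(** Differentiability within [A] implies continuity only if the differential is bounded at
    each point, which linearity alone does not give in an arbitrary normed space. *)
Lemma cont_diff_continuous_curve (V W : normedModType R) (A : set V) (g : V -> W)
    (dg : V -> {linear V -> W}) (c : R -> V) :
  cont_diff_on A g dg -> (forall z, A z -> exists M : R, forall v, `|dg z v| <= M * `|v|) ->
  continuous c -> (forall t, A (c t)) -> continuous (g \o c).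
Proof.
move=> [gdg _] bd cc Ac t; apply/cvgrPdist_le => e e0.
have [M0 HM0] := bd _ (Ac t).
have {HM0} HM v : `|dg (c t) v| <= `|M0| * `|v|.
  by apply: le_trans (HM0 v) _; rewrite ler_wpM2r// ler_norm.
have h1 := gdg _ (Ac t) 1 ltr01.
have h2 : \forall u \near t, A (c u) ->
    `|g (c u) - g (c t) - dg (c t) (c u - c t)| <= 1 * `|c u - c t| := cc t _ h1.
have M1 : 0 < `|M0| + 1 by rewrite ltr_wpDl.
have h3 : \forall u \near t, `|c t - c u| < e / (`|M0| + 1).
  by have /cvgrPdist_lt := cc t; apply; rewrite divr_gt0.
apply: filterS (filterI h2 h3) => u [/(_ (Ac u)) h4 h5].
rewrite distrC; have -> : g (c u) - g (c t) =
  (g (c u) - g (c t) - dg (c t) (c u - c t)) + dg (c t) (c u - c t) by rewrite subrK.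
apply: le_trans (ler_normD _ _) _; apply: le_trans (lerD h4 (HM _)) _.
by rewrite -mulrDl addrC -ler_pdivlMl// distrC mulrC ltW.
Qed.

Lemma linear_row_sum n (W : lmodType R) (psi : 'rV[R]_n -> W) (v : 'rV[R]_n) :
  (forall k u w, psi (k *: u + w) = k *: psi u + psi w) ->
  psi v = \sum_i v 0 i *: psi (delta_mx 0 i).
Proof.
move=> lpsi.
have psi0 : psi 0 = 0.
  have := lpsi 1 0 0; rewrite !scale1r addr0 => /eqP.
  by rewrite -subr_eq0 opprD addrA subrr sub0r oppr_eq0 => /eqP.
have psiD u w : psi (u + w) = psi u + psi w by rewrite -[u]scale1r lpsi !scale1r.
have psiZ k u : psi (k *: u) = k *: psi u by rewrite -[k *: u]addr0 lpsi psi0 addr0.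
rewrite {1}(row_sum_delta v) (big_morph psi psiD psi0).
by apply: eq_bigr => i _; exact: psiZ.
Qed.

Lemma linear_row_bound n (W : normedModType R) (psi : 'rV[R]_n -> W) (v : 'rV[R]_n) :
  (forall k u w, psi (k *: u + w) = k *: psi u + psi w) ->
  `|psi v| <= (\sum_i `|psi (delta_mx 0 i)|) * `|v|.
Proof.
move=> /linear_row_sum ->; apply: le_trans (ler_norm_sum _ _ _) _.
rewrite mulr_suml; apply: ler_sum => i _.
by rewrite normrZ mulrC ler_wpM2l// mx_entry_le.
Qed.

Lemma continuous_bilinear_curve (V1 V2 W : normedModType R) (F : V1 -> V2 -> W)
    (K : R) (A : R -> V1) (B : R -> V2) :
  (forall u v w, F (u - v) w = F u w - F v w) ->
  (forall u v w, F w (u - v) = F w u - F w v) ->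
  (forall u v, `|F u v| <= K * `|u| * `|v|) ->
  continuous A -> continuous B -> continuous (fun t => F (A t) (B t)).
Proof.
move=> Fl Fr FK cA cB t; apply/cvgrPdist_le => e e0.
have {}FK u v : `|F u v| <= `|K| * `|u| * `|v|.
  by apply: le_trans (FK u v) _; rewrite !ler_wpM2r// ler_norm.
pose D := `|K| * (`|B t| + 1 + `|A t|) + 1.
have D0 : 0 < D by rewrite ltr_wpDl// mulr_ge0// !addr_ge0.
have eD : 0 < e / D by rewrite divr_gt0.
have h1 : \forall u \near t, `|A t - A u| < e / D.
  by have /cvgrPdist_lt := cA t; apply.
have h2 : \forall u \near t, `|B t - B u| < e / D.
  by have /cvgrPdist_lt := cB t; apply.
have h3 : \forall u \near t, `|B t - B u| < 1.
  by have /cvgrPdist_lt := cB t; apply.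
apply: filterS (filterI h1 (filterI h2 h3)) => u [/ltW k1 [/ltW k2 /ltW k3]].
have -> : F (A t) (B t) - F (A u) (B u) = F (A t - A u) (B u) + F (A t) (B t - B u).
  by rewrite Fl Fr [RHS]addrC subrKA.
apply: le_trans (ler_normD _ _) _.
have Bu : `|B u| <= `|B t| + 1.
  rewrite -[B u](subKr (B t)); apply: le_trans (ler_normB _ _) _.
  by rewrite lerD2l.
have g1 : `|F (A t - A u) (B u)| <= `|K| * (e / D) * (`|B t| + 1).
  apply: le_trans (FK _ _) _; apply: ler_pM => //.
  by rewrite ler_wpM2l.
have g2 : `|F (A t) (B t - B u)| <= `|K| * `|A t| * (e / D).
  by apply: le_trans (FK _ _) _; rewrite ler_wpM2l// mulr_ge0.
have -> : e = `|K| * (e / D) * (`|B t| + 1) + `|K| * `|A t| * (e / D) + e / D.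
  transitivity (D * (e / D)); first by rewrite mulrCA divff ?lt0r_neq0// mulr1.
  by rewrite /D; ring.
lra.
Qed.

End Tube.

(** Lipschitz continuity, boundedness, continuity along curves, and a first-order expansion at
    the center with quadratic remainder, with the single constant [M].  Continuity is stated
    along curves because the field is controlled only inside the tube. *)
Definition field_bounds (R : realType) (V : normedModType R) (G : V -> R -> V)
    (zb : R -> V) (rho a b M : R) (DG : R -> V -> V) : Prop :=
  [/\ (forall t c c', a <= t <= b -> `|c - zb t| <= rho -> `|c' - zb t| <= rho ->
        `|G c t - G c' t| <= M * `|c - c'|),
     (forall t c, a <= t <= b -> `|c - zb t| <= rho -> `|G c t| <= M),
     (forall (zeta : R -> V) a' b', a <= a' -> a' <= b' -> b' <= b ->
        continuous (zeta \o clamp a' b') ->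
        (forall t, a' <= t <= b' -> `|zeta t - zb t| <= rho) ->
        continuous (fun t => G (zeta (clamp a' b' t)) (clamp a' b' t))),
     (forall t k u w, DG t (k *: u + w) = k *: DG t u + DG t w) &
     (forall t v, a <= t <= b -> `|v| <= rho ->
        `|G (zb t + v) t - G (zb t) t - DG t v| <= M * `|v| ^+ 2)].

Section Field.
Variables (R : realType) (n : nat).
Local Notation V := ('rV[R]_n * 'rV[R]_n)%type.
Local Notation W := ('rV[R]_n * 'M[R]_n)%type.
Variables (B : V -> R -> W) (zb : R -> V) (rho a b L : R).
Variable dg : V * R -> {linear (V * R)%type -> W}.
Let Tb : set (V * R) := [set z | a <= z.2 <= b /\ `|zb z.2 - z.1| <= rho].
Hypotheses (rho0 : 0 < rho) (ab : a <= b).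
Hypothesis czb : continuous (zb \o clamp a b).
Hypothesis Bdg : cont_diff_on Tb (fun z => B z.1 z.2) dg.
Hypothesis dgL : forall (t : R) (c1 c2 v : V), Tb (c1, t) -> Tb (c2, t) ->
  `|dg (c1, t) (v, 0) - dg (c2, t) (v, 0)| <= L * `|c1 - c2| * `|v|.

(** The right-hand side of the coupled system in the pair (state, costate), when [B] returns
    the dynamics and its state Jacobian. *)
Definition costate_field (c : V) (t : R) : V := ((B c t).1, - (c.2 *m (B c t).2)).

(** The differential of [costate_field] at the center of the tube, by the product rule. *)
Definition costate_field_diff (t : R) (v : V) : V :=
  let be := B (zb t) t in let d := dg (zb t, t) (v, 0) in
  (d.1, - (v.2 *m be.2 + (zb t).2 *m d.2)).

Let cl := clamp a b.
Let TbE c t : a <= t <= b -> `|c - zb t| <= rho -> Tb (c, t).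
Proof. by move=> tab h; split => //=; rewrite distrC. Qed.
Let Tbz t : a <= t <= b -> Tb (zb t, t).
Proof. by move=> tab; apply: TbE => //; rewrite subrr normr0 ltW. Qed.
Let cz : continuous (fun t => (zb (cl t), cl t)).
Proof.
by apply: continuous_pair; [exact: czb|exact: continuous_clamp].
Qed.
Let Tbc t : Tb (zb (cl t), cl t).
Proof. by apply: Tbz; exact: clamp_in. Qed.

(** For each fixed vector the differential along the center is continuous in time, hence
    bounded on the segment; finitely many basis vectors suffice. *)
Lemma center_bound : exists2 M : R, 0 <= M & forall t v, a <= t <= b ->
  `|dg (zb t, t) (v, 0)| <= M * `|v|.
Proof.
have H (v : V) : exists M, 0 <= M /\ forall t, a <= t <= b -> `|dg (zb t, t) (v, 0)| <= M.
  have cF : continuous ((fun z => dg z (v, 0)) \o (fun t => (zb (cl t), cl t))).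
    by apply: (within_continuous_comp (Bdg.2 (v, 0))); [exact: cz|exact: Tbc].
  have [M M0 HM] := continuous_bounded a b cF.
  exists M; split=> // t tab; have := HM t tab; by rewrite /= /cl clamp_id.
have [Mf HMf] := choice H.
pose e1 (i : 'I_n) : V := (delta_mx 0 i, 0); pose e2 (i : 'I_n) : V := (0, delta_mx 0 i).
have S1 : 0 <= \sum_i Mf (e1 i) by apply: sumr_ge0 => i _; exact: (HMf _).1.
have S2 : 0 <= \sum_i Mf (e2 i) by apply: sumr_ge0 => i _; exact: (HMf _).1.
exists (\sum_i Mf (e1 i) + \sum_i Mf (e2 i)); first exact: addr_ge0.
move=> t [v1 v2] tab.
have -> : (v1, v2, 0) = (v1, 0, 0) + (0, v2, 0) :> V * R.
  by congr (_, _, _); rewrite /= ?addr0 ?add0r.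
rewrite linearD; apply: le_trans (ler_normD _ _) _; rewrite mulrDl; apply: lerD.
- apply: (le_trans (@linear_row_bound _ _ _ (fun w => dg (zb t, t) (w, 0, 0)) v1 _)).
    by move=> k u w; rewrite -linearP; congr (dg _ _); congr (_, _, _); rewrite /= scaler0 addr0.
  apply: ler_pM => //; first exact: sumr_ge0.
    by apply: ler_sum => i _; exact: (HMf (e1 i)).2.
  exact: (pair_fst_le (v1, v2)).
- apply: (le_trans (@linear_row_bound _ _ _ (fun w => dg (zb t, t) (0, w, 0)) v2 _)).
    by move=> k u w; rewrite -linearP; congr (dg _ _); congr (_, _, _); rewrite /= scaler0 addr0.
  apply: ler_pM => //; first exact: sumr_ge0.
    by apply: ler_sum => i _; exact: (HMf (e2 i)).2.
  exact: (pair_snd_le (v1, v2)).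
Qed.

(** The Lipschitz condition transports the bound from the center to the whole tube. *)
Lemma tube_bound : exists2 M : R, 0 <= M & forall t c v, a <= t <= b ->
  `|c - zb t| <= rho -> `|dg (c, t) (v, 0)| <= M * `|v|.
Proof.
have [Mc Mc0 HMc] := center_bound.
exists (Mc + `|L| * rho); first by rewrite addr_ge0// mulr_ge0// ltW.
move=> t c v tab ct.
rewrite -[dg (c, t) (v, 0)](subrK (dg (zb t, t) (v, 0))) addrC.
apply: le_trans (ler_normD _ _) _; rewrite mulrDl; apply: lerD; first exact: HMc.
apply: le_trans (dgL _ (TbE tab ct) (Tbz tab)) _.
rewrite ler_wpM2r//; apply: (@le_trans _ _ (`|L| * `|c - zb t|)).
  by rewrite ler_wpM2r// ler_norm.
by rewrite ler_wpM2l.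
Qed.

(** Lipschitz bound and first-order expansion of [B] along segments of the tube. *)
Lemma base_field_bounds : exists M : R, [/\ 0 <= M,
  (forall t c c', a <= t <= b -> `|c - zb t| <= rho -> `|c' - zb t| <= rho ->
     `|B c t - B c' t| <= M * `|c - c'|),
  (forall t c, a <= t <= b -> `|c - zb t| <= rho -> `|B c t| <= M),
  (forall t v, a <= t <= b -> `|v| <= rho ->
     `|B (zb t + v) t - B (zb t) t - dg (zb t, t) (v, 0)| <= M * `|v| ^+ 2) &
  (forall (zeta : R -> V) a' b', a <= a' -> a' <= b' -> b' <= b ->
     continuous (zeta \o clamp a' b') ->
     (forall t, a' <= t <= b' -> `|zeta t - zb t| <= rho) ->
     continuous (fun t => B (zeta (clamp a' b' t)) (clamp a' b' t)))].
Proof.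
have [M1 M10 HM1] := tube_bound.
have Bcont (zeta : R -> V) a' b' : a <= a' -> a' <= b' -> b' <= b ->
     continuous (zeta \o clamp a' b') ->
     (forall t, a' <= t <= b' -> `|zeta t - zb t| <= rho) ->
     continuous (fun t => B (zeta (clamp a' b' t)) (clamp a' b' t)).
  move=> aa ab' bb cze tz.
  pose c t := (zeta (clamp a' b' t), clamp a' b' t).
  have := @cont_diff_continuous_curve R _ _ _ _ _ c Bdg; apply.
  - move=> [c0 t0] [/= tab ct]; rewrite distrC in ct.
    exists (M1 + `|dg (c0, t0) (0, 1)|) => -[v r].
    have -> : (v, r) = (v, 0) + r *: (0, 1) :> V * R.
      congr (_, _); rewrite /= ?scaler0 ?addr0// add0r; exact/esym/mulr1.
    rewrite linearD linearZ; apply: le_trans (ler_normD _ _) _.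
    have -> : (v, 0) + r *: (0, 1) = (v, r) :> V * R.
      congr (_, _); rewrite /= ?scaler0 ?addr0// add0r; exact/mulr1.
    rewrite mulrDl; apply: lerD.
      by apply: le_trans (HM1 _ _ _ tab ct) _; rewrite ler_wpM2l// (pair_fst_le (v, r)).
    by rewrite normrZ mulrC ler_wpM2l// (pair_snd_le (v, r)).
  - by apply: continuous_pair; [exact: cze|exact: continuous_clamp].
  - move=> t; have /andP[h1 h2] := clamp_in t ab'.
    apply: TbE; last by apply: tz; rewrite h1.
    by rewrite (le_trans aa)// (le_trans h2).
have BL t c c' : a <= t <= b -> `|c - zb t| <= rho -> `|c' - zb t| <= rho ->
     `|B c t - B c' t| <= M1 * `|c - c'|.
  move=> tab ct ct'.
  have seg (r : R) : 0 <= r <= 1 -> `|c' + r *: (c - c') - zb t| <= rho.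
    move=> /andP[r0 r1].
    have -> : c' + r *: (c - c') - zb t = r *: (c - zb t) + (1 - r) *: (c' - zb t).
      rewrite scalerBl scale1r [RHS]addrCA -scalerBr [c - _ - _]subrACA.
      by rewrite (subrr (zb t)) subr0 addrAC.
    apply: le_trans (ler_normD _ _) _; rewrite !normrZ !ger0_norm ?subr_ge0//.
    have h1 : r * `|c - zb t| <= r * rho by rewrite ler_wpM2l.
    have h2 : (1 - r) * `|c' - zb t| <= (1 - r) * rho by rewrite ler_wpM2l// subr_ge0.
    lra.
  have E r : (c', t) + r *: (c - c', 0) = (c' + r *: (c - c'), t) :> V * R.
    by congr (_, _); rewrite /= scaler0 addr0.
  have := @cont_diff_segment R _ _ Tb _ _ (c', t) (c - c', 0) 0 (M1 * `|c - c'|) Bdg.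
  have E1 : (c', t) + (c - c', 0) = (c, t) :> V * R.
    by congr (_, _); rewrite /= ?addr0// addrC subrK.
  rewrite subr0 E1; apply.
    by move=> r r01; rewrite E; apply: TbE => //; exact: seg.
  by move=> r r01; rewrite E subr0; apply: HM1 => //; exact: seg.
have Bq t v : a <= t <= b -> `|v| <= rho ->
     `|B (zb t + v) t - B (zb t) t - dg (zb t, t) (v, 0)| <= `|L| * `|v| ^+ 2.
  move=> tab vr.
  have seg (r : R) : 0 <= r <= 1 -> `|zb t + r *: v - zb t| <= `|v|.
    move=> /andP[r0 r1]; rewrite addrAC subrr add0r normrZ ger0_norm//.
    by rewrite ler_piMl.
  have E r : (zb t, t) + r *: (v, 0) = (zb t + r *: v, t) :> V * R.
    by congr (_, _); rewrite /= scaler0 addr0.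
  have := @cont_diff_segment R _ _ Tb _ _ (zb t, t) (v, 0)
    (dg (zb t, t) (v, 0)) (`|L| * `|v| ^+ 2) Bdg.
  have E1 : (zb t, t) + (v, 0) = (zb t + v, t) :> V * R.
    by congr (_, _); rewrite /= addr0.
  rewrite E1; apply.
    by move=> r r01; rewrite E; apply: TbE => //; apply: le_trans (seg r r01) vr.
  move=> r r01; rewrite E; have sr := seg r r01.
  apply: le_trans (dgL _ (TbE tab (le_trans sr vr)) (Tbz tab)) _.
  rewrite expr2 mulrA ler_wpM2r//.
  apply: (@le_trans _ _ (`|L| * `|zb t + r *: v - zb t|)).
    by rewrite ler_wpM2r// ler_norm.
  by rewrite ler_wpM2l.
have [M0 M00 HM0] : exists2 M0, 0 <= M0 & forall t, a <= t <= b -> `|B (zb t) t| <= M0.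
  have cB : continuous (fun t => B (zb (clamp a b t)) (clamp a b t)).
    by apply: Bcont => // t _; rewrite subrr normr0 ltW.
  have [M0 M00 HM0] := continuous_bounded a b cB.
  by exists M0 => // t tab; have := HM0 t tab; rewrite clamp_id.
have M1r : 0 <= M1 * rho by rewrite mulr_ge0// ltW.
exists (M0 + M1 * rho + M1 + `|L|); split => //.
- by rewrite !addr_ge0.
- move=> t c c' tab h1 h2; apply: le_trans (BL t c c' tab h1 h2) _.
  by rewrite ler_wpM2r//; have := normr_ge0 L; lra.
- move=> t c tab ct.
  have := BL t c (zb t) tab ct; rewrite subrr normr0 => /(_ (ltW rho0)) h1.
  have h2 : M1 * `|c - zb t| <= M1 * rho by rewrite ler_wpM2l.
  rewrite -[B c t](subrK (B (zb t) t)); apply: le_trans (ler_normD _ _) _.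
  have := HM0 t tab; have := normr_ge0 L; lra.
- move=> t v tab vr; apply: le_trans (Bq t v tab vr) _.
  by rewrite ler_wpM2r ?exprn_ge0//; lra.
Qed.

(** The second component of the field is a product, so its expansion has the remainder
    [zb.2 *m r + v.2 *m (B (zb + v) - B zb)], where [r] is the remainder of [B];
    both terms are quadratic in [v]. *)
Lemma costate_field_bounds : exists M : R,
  0 <= M /\ field_bounds costate_field zb rho a b M costate_field_diff.
Proof.
have [M [M0 BL BK Bq Bc]] := base_field_bounds.
have [Z0 Z00 HZ0] := continuous_bounded a b czb.
have HZ t : a <= t <= b -> `|zb t| <= Z0.
  by move=> tab; have := HZ0 t tab; rewrite /= clamp_id.
pose Z := Z0 + rho; have Z_ge0 : 0 <= Z by rewrite addr_ge0// ltW.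
have HZc t c : a <= t <= b -> `|c - zb t| <= rho -> `|c| <= Z.
  move=> tab ct; rewrite -[c](subrK (zb t)) addrC; apply: le_trans (ler_normD _ _) _.
  by apply: lerD => //; exact: HZ.
have n0 : 0 <= n%:R :> R by [].
have nZ : 0 <= n%:R * Z * M by rewrite !mulr_ge0.
have nM : 0 <= n%:R * M by rewrite mulr_ge0.
pose N := M + n%:R * Z * M + n%:R * M.
exists N; split; first by rewrite /N; lra.
have mulb (w : 'rV[R]_n) (A : 'M[R]_n) (p r : R) : `|w| <= p -> `|A| <= r ->
    `|w *m A| <= n%:R * p * r.
  move=> wp Ar; apply: le_trans (mulmx_norm_le _ _) _.
  by apply: ler_pM => //; exact: ler_wpM2l.
split.
- move=> t c c' tab h h'.
  have hL := BL t c c' tab h h'.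
  have Ln : `|(B c t - B c' t).2| <= M * `|c - c'| by exact: le_trans (pair_snd_le _) hL.
  have cc : `|c.2 - c'.2| <= `|c - c'| by exact: (pair_snd_le (c - c')).
  have MN : 0 <= `|c - c'| by [].
  apply: pair_norm_le.
    apply: (le_trans (pair_fst_le (B c t - B c' t))); apply: le_trans hL _.
    by rewrite ler_wpM2r// /N; lra.
  rewrite /= -opprD normrN.
  have -> : c.2 *m (B c t).2 - c'.2 *m (B c' t).2 =
     (c.2 - c'.2) *m (B c t).2 + c'.2 *m (B c t - B c' t).2.
    by rewrite mulmxBl mulmxBr [RHS]addrC addrC subrKA addrC.
  apply: le_trans (ler_normD _ _) _.
  have h1 : `|(c.2 - c'.2) *m (B c t).2| <= n%:R * `|c - c'| * M.
    by apply: mulb => //; apply: le_trans (pair_snd_le _) _; exact: BK.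
  have h2 : `|c'.2 *m (B c t - B c' t).2| <= n%:R * Z * (M * `|c - c'|).
    by apply: mulb => //; apply: le_trans (pair_snd_le _) _; exact: HZc h'.
  apply: le_trans (lerD h1 h2) _.
  have -> : N * `|c - c'| = n%:R * `|c - c'| * M + n%:R * Z * (M * `|c - c'|) + M * `|c - c'|.
    by rewrite /N; ring.
  by rewrite lerDl mulr_ge0.
- move=> t c tab h; have hK := BK t c tab h.
  apply: pair_norm_le.
    apply: (le_trans (pair_fst_le (B c t))); apply: le_trans hK _; rewrite /N; lra.
  rewrite /= normrN.
  have h1 : `|c.2 *m (B c t).2| <= n%:R * Z * M.
    apply: mulb; first by apply: le_trans (pair_snd_le _) _; exact: HZc h.
    exact: le_trans (pair_snd_le _) hK.
  by apply: le_trans h1 _; rewrite /N; lra.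
- move=> ze a' b' aa ab' bb cze tz; have cB := Bc ze a' b' aa ab' bb cze tz.
  apply: continuous_pair.
    move=> t; apply: (@continuous_comp _ _ _
      (fun t => B (ze (clamp a' b' t)) (clamp a' b' t)) fst); first exact: cB.
    exact: cvg_fst.
  move=> t; apply: cvgN; apply: (continuous_bilinear_curve
    (fun u v w => mulmxBl u v w) (fun u v w => mulmxBr w u v) (@mulmx_norm_le R 1 n n)) => u.
    by apply: (@continuous_comp _ _ _ (ze \o clamp a' b') snd); [exact: cze|exact: cvg_snd].
  apply: (@continuous_comp _ _ _
    (fun t => B (ze (clamp a' b' t)) (clamp a' b' t)) snd); first exact: cB.
  exact: cvg_snd.
- move=> t k u w; rewrite /costate_field_diff.
  have -> : (k *: u + w, 0) = k *: (u, 0) + (w, 0) :> V * R.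
    by congr (_, _); rewrite /= scaler0 addr0.
  rewrite linearP; congr (_, _) => /=.
  rewrite mulmxDl mulmxDr -!scalemxAl -!scalemxAr scalerN scalerDr.
  by rewrite -opprD addrACA.
- move=> t v tab vr; have hq := Bq t v tab vr.
  set be := B (zb t) t in hq *; set d := dg (zb t, t) (v, 0) in hq *.
  set bc := B (zb t + v) t in hq *.
  have hv : `|zb t + v - zb t| <= rho by rewrite addrAC subrr add0r.
  have hL : `|bc - be| <= M * `|v|.
    have := BL t (zb t + v) (zb t) tab hv; rewrite subrr normr0 (ltW rho0) => /(_ isT).
    by rewrite (addrAC (zb t)) subrr add0r.
  have v2 : 0 <= `|v| ^+ 2 by rewrite exprn_ge0.
  apply: pair_norm_le.
    apply: (le_trans (pair_fst_le (bc - be - d))); apply: le_trans hq _.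
    by rewrite ler_wpM2r// /N; lra.
  rewrite /= -/be -/d -/bc.
  have -> : - (((zb t).2 + v.2) *m bc.2) - - ((zb t).2 *m be.2) -
     - (v.2 *m be.2 + (zb t).2 *m d.2) =
     - ((zb t).2 *m (bc - be - d).2 + v.2 *m (bc - be).2).
    rewrite /= !mulmxBr mulmxDl !(opprD, opprK) -!addrA; congr (_ + _).
    by rewrite addrCA; congr (_ + _); rewrite [RHS]addrCA (addrC (v.2 *m _)).
  rewrite normrN; apply: le_trans (ler_normD _ _) _.
  have h1 : `|(zb t).2 *m (bc - be - d).2| <= n%:R * Z * (M * `|v| ^+ 2).
    apply: mulb; last exact: le_trans (pair_snd_le _) hq.
    apply: le_trans (pair_snd_le _) _; apply: (HZc t) => //.
    by rewrite subrr normr0 ltW.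
  have h2 : `|v.2 *m (bc - be).2| <= n%:R * `|v| * (M * `|v|).
    apply: mulb; first exact: pair_snd_le.
    exact: le_trans (pair_snd_le _) hL.
  apply: le_trans (lerD h1 h2) _.
  have -> : N * `|v| ^+ 2 = n%:R * Z * (M * `|v| ^+ 2) + n%:R * `|v| * (M * `|v|) + M * `|v| ^+ 2.
    by rewrite /N; ring.
  by rewrite lerDl mulr_ge0.
Qed.

End Field.

(** * Moving one switching point *)

Definition switched_solution (R : realType) (V : normedModType R) (k : nat) (T : R)
    (G : nat -> V -> R -> V) (s : nat -> R) (z0 : V) (z : R -> V) : Prop :=
  [/\ z 0 = z0, abs_continuous 0 T z &
    {ae @lebesgue_measure R, forall t i, (i <= k)%N -> s i < t < s i.+1 ->
       has_deriv z t (G i (z t) t)}].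

Definition move_switch (R : realType) (s : nat -> R) (j : nat) (h : R) (i : nat) : R :=
  if i == j then s i + h else s i.

Section Sensitivity.
Variables (R : realType) (V : normedModType R).
Hypotheses (Vprim : has_primitives V) (Vcomp : geometric_complete V).
Variables (k : nat) (T : R) (s lo hi : nat -> R).
Variables (G : nat -> V -> R -> V) (DG : nat -> R -> V -> V).
Variables (zb : R -> V) (rho M : R) (j : nat).
Hypotheses (jk : (j < k)%N) (s0 : s 0%N = 0) (sT : s k.+1 = T).
Hypothesis smono : forall i, (i <= k)%N -> s i < s i.+1.
Hypothesis slo : forall i, (i <= k)%N -> lo i <= s i.
Hypothesis shi : forall i, (i <= k)%N -> s i.+1 <= hi i.
Hypotheses (jlo : s j < lo j.+1) (loj : lo j.+1 < s j.+1).
Hypotheses (jhi : s j.+1 < hi j) (hij : hi j < s j.+2).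
Hypotheses (rho0 : 0 < rho) (M0 : 0 < M).
Hypothesis GM : forall i, (i <= k)%N ->
  field_bounds (G i) zb rho (lo i) (hi i) M (DG i).
Hypothesis zbsol : switched_solution k T G s (zb 0) zb.
Local Notation mu := (@lebesgue_measure R).
Local Notation tau := (s j.+1).
Local Notation s' h := (move_switch s j.+1 h).

Definition shift_range := Num.min (tau - lo j.+1) (hi j - tau).

(** The length of the part of [0, t] on which the original and the shifted switching points
    select different fields. *)
Definition mismatch (h t : R) : R :=
  clamp (Num.min tau (tau + h)) (Num.max tau (tau + h)) t - Num.min tau (tau + h).

Lemma shift_range_gt0 : 0 < shift_range.
Proof. by rewrite /shift_range lt_min !subr_gt0 loj. Qed.

Section Shift.
Variable h : R.
Hypothesis hs : `|h| < shift_range.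

Let hlo : lo j.+1 < tau + h.
Proof.
by move: hs; rewrite /shift_range lt_min ltr_norml => /andP[/andP[h1 h2] _]; lra.
Qed.
Let hhi : tau + h < hi j.
Proof.
move: hs; rewrite /shift_range lt_min => /andP[_]; rewrite ltr_norml => /andP[h1 h2]; lra.
Qed.

Lemma move_switch_neq i : i != j.+1 -> s' h i = s i.
Proof. by rewrite /move_switch => /negPf->. Qed.
Lemma move_switch_eq : s' h j.+1 = tau + h.
Proof. by rewrite /move_switch eqxx. Qed.

Lemma move_switch_first : s' h 0%N = 0. Proof. by rewrite move_switch_neq. Qed.
Lemma move_switch_last : s' h k.+1 = T.
Proof. by rewrite move_switch_neq// eqSS gtn_eqF. Qed.

Lemma move_switch_mono i : (i <= k)%N -> s' h i < s' h i.+1.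
Proof.
move=> ik; case: (eqVneq i j) => [->|ij].
  by rewrite move_switch_eq move_switch_neq ?ltn_eqF// (lt_trans jlo).
rewrite [s' h i.+1]move_switch_neq ?eqSS//; case: (eqVneq i j.+1) => [->|ij'].
  by rewrite move_switch_eq (lt_trans hhi).
by rewrite move_switch_neq// smono.
Qed.

Lemma move_switch_lo i : (i <= k)%N -> lo i <= s' h i.
Proof.
move=> ik; case: (eqVneq i j.+1) => [->|ij]; first by rewrite move_switch_eq ltW.
by rewrite move_switch_neq// slo.
Qed.

Lemma move_switch_hi i : (i <= k)%N -> s' h i.+1 <= hi i.
Proof.
move=> ik; case: (eqVneq i j) => [->|ij]; first by rewrite move_switch_eq ltW.
by rewrite move_switch_neq ?eqSS// shi.
Qed.

Let sle := switching_le smono.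
Let switching_le' := switching_le move_switch_mono.

Lemma move_switch_unique i i' t : (i <= k)%N -> (i' <= k)%N -> s' h i < t < s' h i.+1 ->
  s' h i' < t < s' h i'.+1 -> i = i'.
Proof.
move=> ik ik' /andP[h1 h2] /andP[h3 h4]; case: (ltngtP i i') => // ii.
- by have := switching_le' ii (leqW ik') => h5; exfalso; lra.
- by have := switching_le' ii (leqW ik) => h5; exfalso; lra.
Qed.

Let alpha := Num.min tau (tau + h).
Let beta := Num.max tau (tau + h).

Let alpha0 : 0 <= alpha.
Proof.
have := sle (leq0n j) (leqW (ltnW jk)); rewrite s0 /alpha le_min => h1.
have := loj; have := jlo; have := hlo => a b c; apply/andP; split; lra.
Qed.
Let ab : alpha <= beta.
Proof. by rewrite /alpha /beta ge_min le_max lexx. Qed.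
Let betaT : beta <= T.
Proof.
have := @sle j.+2 k.+1 jk (leqnn _); rewrite sT /beta ge_max => h1.
have := hij; have := jhi; have := hhi => a b c; apply/andP; split; lra.
Qed.
Let T0 : 0 <= T.
Proof. exact: le_trans alpha0 (le_trans ab betaT). Qed.
Let ba : beta - alpha = `|h|.
Proof.
rewrite /alpha /beta; case: (leP 0 h) => h0.
  by rewrite min_l ?max_r ?lerDl// addrC addKr ger0_norm.
rewrite min_r ?max_l ?gerDl ?ltW//.
  by rewrite opprD addNKr ltr0_norm.
all: by lra.
Qed.

Lemma mismatch0 : mismatch h 0 = 0.
Proof. by rewrite /mismatch clamp_left ?subrr. Qed.
Lemma mismatchT : mismatch h T = `|h|.
Proof. by rewrite /mismatch clamp_right. Qed.
Lemma mismatch_mono u v : u <= v -> mismatch h u <= mismatch h v.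
Proof. by move=> uv; rewrite lerD2r clamp_mono. Qed.
Lemma mismatch_ge0 t : 0 <= t -> 0 <= mismatch h t.
Proof. by move=> t0; rewrite -mismatch0 mismatch_mono. Qed.

Lemma mismatch_out t : t < alpha \/ beta < t -> has_deriv (mismatch h) t 0.
Proof.
case=> ht.
  apply: (@has_deriv_near _ _ (fun=> alpha - alpha)); last exact: has_deriv_cst.
  by apply: filterS (lt_nbhsl ht) => u /ltW ua; rewrite /mismatch clamp_left.
apply: (@has_deriv_near _ _ (fun=> beta - alpha)); last exact: has_deriv_cst.
by apply: filterS (lt_nbhsr ht) => u /ltW ua; rewrite /mismatch clamp_right.
Qed.

Lemma mismatch_in t : alpha < t < beta -> has_deriv (mismatch h) t 1.
Proof.
move=> /andP[ht tb]; apply: (@has_deriv_near _ _ (fun u => u - alpha)).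
  apply: filterS (filterI (lt_nbhsr ht) (lt_nbhsl tb)) => u [/ltW au /ltW ub].
  by rewrite /mismatch clamp_id// au ub.
rewrite -[1]subr0; apply: has_derivB; [exact: has_deriv_id|exact: has_deriv_cst].
Qed.

Definition same_field (t : R) (i i' : nat) := i = i' /\ has_deriv (mismatch h) t 0.
Definition swapped_field (t : R) (i i' : nat) :=
  [/\ has_deriv (mismatch h) t 1, `|t - tau| <= `|h| &
  (0 < h /\ i = j.+1 /\ i' = j) \/ (h < 0 /\ i = j /\ i' = j.+1)].

(** Outside the finitely many switching points, the two systems use the same field, except
    between [tau] and [tau + h]: there the shifted system is still in phase [j] when [h > 0]
    and already in phase [j.+1] when [h < 0]. *)
Lemma ae_fields : {ae mu, forall t, 0 < t < T -> exists i i',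
  [/\ (i <= k)%N, (i' <= k)%N, s i < t < s i.+1, s' h i' < t < s' h i'.+1 &
      same_field t i i' \/ swapped_field t i i']}.
Proof.
have h1 := ae_switch s0 sT; have h2 := ae_switch move_switch_first move_switch_last.
apply: (ae_mono _ (ae_and (ae_and h1 h2) (ae_and (ae_neq tau) (ae_neq (tau + h))))).
move=> t [[k1 k2] [k3 k4]] t0T.
have [i ik /andP[si1 si2]] := k1 t0T; have [i' ik' /andP[si1' si2']] := k2 t0T.
exists i, i'; split => //; rewrite ?si1 ?si1'//.
have kj : (j <= k)%N := ltnW jk.
have out : t < alpha \/ beta < t \/ alpha < t < beta.
  rewrite /alpha /beta lt_min gt_max lt_max gt_min.
  by case: ltgtP k3 => // _ _; case: ltgtP k4 => // _ _; [left|right;right|right;right|right;left].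
have case_same : s' h i < t < s' h i.+1 -> ~~ (alpha < t < beta) ->
    same_field t i i' \/ swapped_field t i i'.
  move=> hi' nab; left; split; first by apply: (@move_switch_unique _ _ t) => //; rewrite si1'.
  by apply: mismatch_out; case: out => [|[|]]; [left|right|move=> hab; rewrite hab in nab].
have case_swap i0 : (i0 <= k)%N -> s' h i0 < t < s' h i0.+1 -> alpha < t < beta ->
    (0 < h /\ i = j.+1 /\ i0 = j) \/ (h < 0 /\ i = j /\ i0 = j.+1) ->
    same_field t i i' \/ swapped_field t i i'.
  move=> i0k hi0 hab hh; right.
  have <- : i0 = i' by apply: (@move_switch_unique _ _ t) => //; rewrite si1'.
  split => //; first exact: mismatch_in.
  have := ba; have /andP[b1 b2] := hab.
  have a1 : alpha <= tau by rewrite /alpha ge_min lexx.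
  have a2 : tau <= beta by rewrite /beta le_max lexx.
  by move=> b3; rewrite ler_norml; apply/andP; split; lra.
have abE : (alpha < t < beta) =
    ((tau < t) || (tau + h < t)) && ((t < tau) || (t < tau + h)).
  by rewrite /alpha /beta gt_min lt_max.
case: (eqVneq i j) => [ij|nij].
  rewrite ij in si1 si2.
  have [t1|] := ltP t (tau + h).
    apply: case_same; first by rewrite ij move_switch_eq t1 move_switch_neq ?ltn_eqF// si1.
    by rewrite abE !ltNge (ltW t1) (ltW si2).
  rewrite le_eqVlt eq_sym (negPf k4)/= => t1.
  apply: (case_swap j.+1) => //.
  - by rewrite move_switch_eq t1/= move_switch_neq ?gtn_eqF// (lt_trans si2)// smono.
  - by rewrite abE t1 si2 orbT.
  - by right; split=> //; lra.
case: (eqVneq i j.+1) => [ij|nij'].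
  rewrite ij in si1 si2.
  have [t1|] := ltP t (tau + h).
    apply: (case_swap j) => //.
    - by rewrite move_switch_eq t1 move_switch_neq ?ltn_eqF// andbT (lt_trans _ si1)// smono.
    - by rewrite abE t1 si1 orbT.
    - by left; split=> //; lra.
  rewrite le_eqVlt eq_sym (negPf k4)/= => t1.
  apply: case_same; first by rewrite ij move_switch_eq t1/= move_switch_neq ?gtn_eqF.
  by rewrite abE negb_and !negb_or -!leNgt (ltW t1) (ltW si1) orbT.
apply: case_same; first by rewrite !move_switch_neq ?eqSS// si1.
rewrite abE; case: (ltngtP i j) => [ij|ij|ij]; last by rewrite ij eqxx in nij.
  have h5 : t < s j by apply: lt_le_trans si2 _; apply: sle => //; exact: leqW.
  have := jlo; have := loj; have := hlo => *; rewrite negb_and !negb_or -!leNgt.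
  by apply/orP; left; apply/andP; split; lra.
have ij2 : (j.+2 <= i)%N by rewrite ltn_neqAle eq_sym nij' ij.
have h5 : s j.+2 < t by apply: le_lt_trans si1; apply: sle => //; exact: leqW.
have := jhi; have := hij; have := hhi => *; rewrite negb_and !negb_or -!leNgt.
by apply/orP; right; apply/andP; split; lra.
Qed.

Local Notation E t := (expR (2 * M * t)).

Let window i t : (i <= k)%N -> s i < t < s i.+1 -> lo i <= t <= hi i.
Proof.
move=> ik /andP[h1 h2]; rewrite (le_trans (slo ik) (ltW h1)).
by rewrite (le_trans (ltW h2) (shi ik)).
Qed.
Let window' i t : (i <= k)%N -> s' h i < t < s' h i.+1 -> lo i <= t <= hi i.
Proof.
move=> ik /andP[h1 h2]; rewrite (le_trans (move_switch_lo ik) (ltW h1)).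
by rewrite (le_trans (ltW h2) (move_switch_hi ik)).
Qed.
Let zb0 t : `|zb t - zb t| <= rho.
Proof. by rewrite subrr normr0 ltW. Qed.

(** Twice the total [2 M |h|] of the defect between the two fields, times the Gronwall factor. *)
Definition drift (h : R) : R := 4 * M * `|h| * E T.
Hypothesis hrho : drift h < rho.

Lemma drift_ge0 : 0 <= drift h.
Proof. by rewrite !mulr_ge0 ?expR_ge0// ltW. Qed.

(** The derivative of the deviation is the sum of a Lipschitz term and of the difference of two
    fields, present only between the two positions of the switching point. *)
Lemma drift_before (z : R -> V) t1 : switched_solution k T G (s' h) (zb 0) z ->
  0 <= t1 <= T -> (forall u, 0 <= u <= t1 -> `|z u - zb u| <= rho) ->
  forall u, 0 <= u <= t1 -> `|z u - zb u| <= drift h.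
Proof.
move=> [z0 acz dz] /andP[t10 t1T] zr u ut1.
have [_ aczb dzb] := zbsol.
have := @gronwall R V M t1 (fun t => 2 * M * mismatch h t) M0 _ (fun t => z t - zb t) t10.
rewrite z0 subrr => H; have {H} := H _ erefl _ _ u ut1.
rewrite mismatch0 mulr0 subr0 => H.
apply: (@le_trans _ _ (2 * (2 * M * mismatch h t1) * E u)).
  apply: H.
  - by move=> a c _ ac _; rewrite ler_pM2l ?mismatch_mono// mulr_gt0.
  - apply: (@abs_continuous_sub _ _ _ 0 T) => //.
    apply: (@abs_continuous_dom _ _ _ _ _ z zb _ _ 1) => //.
    by move=> a c _ _ _; rewrite mul1r subrACA; exact: ler_normB.
  - apply: (ae_mono _ (ae_and ae_fields (ae_and dz dzb))).
    move=> t [ft [dzt dzbt]] /andP[tt0 tt1].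
    have t0T : 0 < t < T by rewrite tt0 (lt_le_trans tt1).
    have zt : `|z t - zb t| <= rho by apply: zr; rewrite !ltW.
    have [i [i' [ik ik' si si' fi]]] := ft t0T.
    have d1 := dzt i' ik' si'; have d2 := dzbt i ik si.
    have [GL GK _ _ _] := GM ik; have [GL' GK' _ _ _] := GM ik'.
    have hL := GL' t _ _ (window' ik' si') zt (zb0 t).
    exists (G i' (z t) t - G i (zb t) t).
    case: fi => [[ii' dm]|[dm _ _]].
      exists (2 * M * 0); split; [exact: has_derivB|exact: has_deriv_scale|].
      by rewrite mulr0 addr0 ii'.
    exists (2 * M * 1); split; [exact: has_derivB|exact: has_deriv_scale|].
    rewrite -[_ - _](subrKA (G i' (zb t) t)); apply: le_trans (ler_normD _ _) _.
    apply: lerD => //; apply: le_trans (ler_normB _ _) _.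
    apply: le_trans (lerD (GK' _ _ (window' ik' si') (zb0 t)) (GK _ _ (window ik si) (zb0 t))) _.
    by rewrite mulr1 mulr_natl mulr2n.
rewrite /drift.
have h1 : mismatch h t1 <= `|h| by rewrite -mismatchT mismatch_mono.
have h2 : E u <= E T.
  by rewrite ler_expR ler_pM2l ?mulr_gt0//; case/andP: ut1 => _ /le_trans; apply.
apply: ler_pM => //.
  by rewrite !mulr_ge0// ?(ltW M0)// mismatch_ge0.
have -> : 4 * M * `|h| = 2 * (2 * M * `|h|) by ring.
by rewrite ler_pM2l// ler_pM2l ?mulr_gt0.
Qed.

(** A solution of the shifted system could leave the tube, where nothing is known of the
    fields.  By real induction it does not: as long as it stays in the tube it is within
    [drift h < rho] of the center, and uniform continuity leaves room to go on. *)
Lemma drift_bound (z : R -> V) : switched_solution k T G (s' h) (zb 0) z ->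
  forall u, 0 <= u <= T -> `|z u - zb u| <= drift h.
Proof.
move=> zsol; have [z0 acz dz] := zsol; have [_ aczb _] := zbsol.
pose P u v := (forall w, 0 <= w <= u -> `|z w - zb w| <= drift h) ->
  forall w, 0 <= w <= v -> `|z w - zb w| <= drift h.
suff : P 0 T.
  apply=> w /andP[w0 w0']; have -> : w = 0 by apply/eqP; rewrite eq_le w0 w0'.
  by rewrite z0 subrr normr0 drift_ge0.
apply: cousin => //; first by move=> u v w _ _ _ _ Puv Pvw; move/Puv/Pvw.
move=> t t0T.
have acd : abs_continuous 0 T (fun t => z t - zb t).
  apply: (@abs_continuous_dom _ _ _ _ _ z zb _ _ 1) => //.
  by move=> a c _ _ _; rewrite mul1r subrACA; exact: ler_normB.
have gap : 0 < rho - drift h by rewrite subr_gt0.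
have [d d0 Hd] := abs_continuous_unif acd gap.
exists d => // u v u0 ut tv vT uvd Hu.
have uv := le_trans ut tv.
apply: (drift_before zsol); first by rewrite vT (le_trans u0).
move=> w /andP[w0 wv]; have [wu|uw] := leP w u.
  by apply: le_trans (ltW hrho); apply: Hu; rewrite w0.
have h1 : `|z u - zb u| <= drift h by apply: Hu; rewrite u0 lexx.
have h2 : `|z w - zb w - (z u - zb u)| < rho - drift h.
  apply: Hd; rewrite ?w0 ?u0 ?(le_trans wv)// ?(le_trans uv)//.
  by rewrite gtr0_norm ?subr_gt0//; lra.
rewrite -[z w - zb w](subrK (z u - zb u)); apply: le_trans (ler_normD _ _) _; lra.
Qed.

(** The unshifted trajectory is an approximate solution of the shifted system, with a defect
    of at most [2 M] on an interval of length [|h|]. *)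
Lemma shifted_solution : exists z, switched_solution k T G (s' h) (zb 0) z.
Proof.
have [_ aczb dzb] := zbsol.
have := @picard_solution R V Vprim Vcomp k T (s' h) lo hi G zb rho M M M0 (ltW M0)
  move_switch_first move_switch_last move_switch_mono move_switch_lo move_switch_hi
  _ _ _ (fun t => 2 * M * mismatch h t) _ aczb _ _.
case.
- by move=> i t c c' ik; have [GL _ _ _ _] := GM ik; exact: GL.
- by move=> i t c ik; have [_ GK _ _ _] := GM ik; exact: GK.
- by move=> i ze a b ik; have [_ _ GC _ _] := GM ik; exact: GC.
- by move=> u v _ uv _; rewrite ler_pM2l ?mulr_gt0// mismatch_mono.
- apply: (ae_mono _ (ae_and ae_fields dzb)) => t [ft dzbt] i0 ik0 si0.
  have t0T := phase_in_horizon move_switch_first move_switch_last move_switch_mono ik0 si0.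
  have [i [i' [ik ik' si si' fi]]] := ft t0T.
  have ii0 := move_switch_unique ik0 ik' si0 si'; rewrite ii0.
  have d2 := dzbt i ik si.
  exists (G i (zb t) t); case: fi => [[ii' dm]|[dm _ _]].
    exists (2 * M * 0); split => //; first exact: has_deriv_scale.
    by rewrite ii' subrr normr0 mulr0.
  exists (2 * M * 1); split => //; first exact: has_deriv_scale.
  have [_ GK _ _ _] := GM ik; have [_ GK' _ _ _] := GM ik'.
  apply: le_trans (ler_normB _ _) _.
  apply: le_trans (lerD (GK' _ _ (window' ik' si') (zb0 t)) (GK _ _ (window ik si) (zb0 t))) _.
  by rewrite mulr1 mulr_natl mulr2n.
- rewrite mismatch0 mismatchT mulr0 subr0; apply: ltW.
  have -> : 2 * (2 * M * `|h|) * E T = drift h by rewrite /drift; ring.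
  exact: hrho.
move=> z [z0 acz dz]; exists z; split => //.
by apply: aeW => t i; exact: dz.
Qed.

End Shift.
Section Adjoint.
Variables (dot : V -> V -> R) (Dd : R) (Y : R -> V).
Hypothesis dotl : forall u v w, dot (u - v) w = dot u w - dot v w.
Hypothesis dotr : forall u v w, dot w (u - v) = dot w u - dot w v.
Hypothesis dotZl : forall c u v, dot (c *: u) v = c * dot u v.
Hypothesis dotZr : forall c u v, dot u (c *: v) = c * dot u v.
Hypothesis dotD : forall u v, `|dot u v| <= Dd * `|u| * `|v|.
Hypothesis Dd0 : 0 <= Dd.
Hypothesis acY : abs_continuous 0 T Y.
Hypothesis dY : {ae mu, forall t i, (i <= k)%N -> s i < t < s i.+1 ->
  exists2 Y', has_deriv Y t Y' & forall v, dot Y' v = - dot (Y t) (DG i t v)}.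

(** The difference of the two Hamiltonians at the switching point. *)
Definition jump : R := dot (Y tau) (G j (zb tau) tau - G j.+1 (zb tau) tau).

Let dotDr u v w : dot w (u + v) = dot w u + dot w v.
Proof. by rewrite -{1}[v]opprK dotr -[- v]scaleN1r dotZr mulN1r opprK. Qed.
Let horizon_ge0 : 0 <= T.
Proof. by have := switching_le smono (leq0n k.+1) (leqnn _); rewrite s0 sT. Qed.
Lemma jump_near (e : R) : 0 < e -> exists2 d : R, 0 < d & forall t : R, `|t - tau| < d ->
  lo j.+1 <= t <= hi j ->
  `|dot (Y t) (G j (zb t) t - G j.+1 (zb t) t) - jump| <= e.
Proof.
move=> e0; have [_ aczb _] := zbsol.
have kj : (j <= k)%N := ltnW jk.
have lh : lo j.+1 <= hi j by apply: ltW; exact: lt_trans loj jhi.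
have lo0 : 0 <= lo j.+1.
  have := switching_le smono (leq0n j) (leqW kj); rewrite s0 => h1.
  by apply: ltW; exact: le_lt_trans jlo.
have hT : hi j <= T.
  have := @switching_le _ _ _ smono j.+2 k.+1 jk (leqnn _); rewrite sT => h1.
  by apply: ltW; exact: lt_le_trans hij _.
pose c := clamp (lo j.+1) (hi j).
have cin t : lo j.+1 <= c t <= hi j by exact: clamp_in.
have c0T (U : normedModType R) (F : R -> U) : abs_continuous 0 T F -> continuous (F \o c).
  move=> acF; apply: continuous_abs_clamp => //; exact: (abs_continuous_sub lo0 hT acF).
have zr t : lo j.+1 <= t <= hi j -> `|zb t - zb t| <= rho by move=> _; rewrite subrr normr0 ltW.
have cG i : (i <= k)%N -> lo i <= lo j.+1 -> hi j <= hi i ->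
    continuous (fun t => G i (zb (c t)) (c t)).
  by move=> ik h1 h2; have [_ _ GC _ _] := GM ik; apply: GC => //; exact: c0T.
have cF : continuous (fun t => dot (Y (c t)) (G j (zb (c t)) (c t) - G j.+1 (zb (c t)) (c t))).
  apply: (continuous_bilinear_curve dotl dotr dotD); first exact: c0T.
  move=> t; apply: cvgB; apply: cG => //.
  - apply: le_trans (slo kj) _; exact: ltW.
  - apply: le_trans _ (shi jk); exact: ltW.
have ctau : c tau = tau by rewrite /c clamp_id// !ltW.
have /cvgrPdist_le := cF tau; rewrite ctau => /(_ e e0) /nbhs_ballP[d /= d0 Hd].
exists d => // t td tw; have := Hd t; rewrite /ball/= distrC => /(_ td).
by rewrite /c clamp_id// distrC.
Qed.

(** The function [w t = dot (Y t) (z t - zb t)] has derivative [O(h ^ 2)] where the fields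
    agree, because [Y] solves the adjoint equation and the first-order terms cancel.  Where
    they differ, its derivative is [jump] up to sign and a small error.  Subtracting
    [sg * jump * mismatch h] leaves a function with increment [o(h)] on the horizon. *)
Lemma first_order_effect (e : R) : 0 < e -> exists2 eta : R, 0 < eta &
  forall h z, `|h| < eta -> `|h| < shift_range -> drift h < rho ->
    switched_solution k T G (s' h) (zb 0) z ->
    `|dot (Y T) (z T - zb T) - h * jump| <= e * `|h|.
Proof.
move=> e0; have [_ aczb dzb] := zbsol.
have [YB YB0 HYB] := continuous_bounded 0 T (continuous_abs_clamp horizon_ge0 acY).
have {HYB}HYB t : 0 <= t <= T -> `|Y t| <= YB.
  by move=> tT; have := HYB t tT; rewrite /= clamp_id.
pose C := 4 * M * expR (2 * M * T).
have C0 : 0 <= C by rewrite mulr_ge0 ?expR_ge0// mulr_ge0// ltW.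
pose DY := Dd * YB.
have DY0 : 0 <= DY by exact: mulr_ge0.
have dotY t v (c : R) : 0 <= t <= T -> `|v| <= c -> `|dot (Y t) v| <= DY * c.
  move=> tT vc; apply: le_trans (dotD _ _) _; apply: ler_pM => //.
    by rewrite mulr_ge0.
  by rewrite ler_wpM2l// HYB.
pose k1 := DY * (M * C ^+ 2); pose k2 := DY * (2 * M * C).
have k10 : 0 <= k1 by rewrite /k1 !mulr_ge0 ?exprn_ge0// ltW.
have k20 : 0 <= k2 by rewrite /k2 !mulr_ge0// ltW.
have e20 : 0 < e / 2 by rewrite divr_gt0.
have [d d0 Hd] := jump_near e20.
pose N := k1 * T + k1 + k2 + 1.
have N0 : 0 < N by rewrite /N ltr_wpDl// !addr_ge0// mulr_ge0.
exists (Num.min d (Num.min 1 (e / 2 / N))).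
  by rewrite !lt_min d0 ltr01 divr_gt0.
move=> h z hmin hs hrho zsol; move: hmin; rewrite !lt_min => /and3P[hd h1 hN].
have zd := drift_bound hs hrho zsol; have [z0 acz dz] := zsol.
have {}zd t : 0 <= t <= T -> `|z t - zb t| <= C * `|h|.
  by move=> /zd; rewrite /drift /C mulrAC.
have zr t : 0 <= t <= T -> `|z t - zb t| <= rho.
  by move=> tT; apply: le_trans (drift_bound hs hrho zsol tT) (ltW hrho).
pose sg : R := if 0 < h then 1 else - 1.
have sgh : sg * `|h| = h.
  by rewrite /sg; case: ltP => h0; [rewrite gtr0_norm ?mul1r|rewrite ler0_norm// mulN1r opprK].
pose w t := dot (Y t) (z t - zb t).
have acd : abs_continuous 0 T (fun t => z t - zb t).
  apply: (@abs_continuous_dom _ _ _ _ _ z zb _ _ 1) => //.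
  by move=> a c _ _ _; rewrite mul1r subrACA; exact: ler_normB.
have acw : abs_continuous 0 T w.
  apply: (@abs_continuous_dom _ _ _ _ _ Y (fun t => z t - zb t) _ _ (Dd * (YB + rho))) => //.
  move=> u v u0 uv vT.
  have uT : 0 <= u <= T by rewrite u0 (le_trans uv).
  have vT' : 0 <= v <= T by rewrite vT (le_trans u0).
  have -> : w v - w u = dot (Y v - Y u) (z v - zb v) + dot (Y u) (z v - zb v - (z u - zb u)).
    by rewrite (dotl (Y v)) (dotr (z v - zb v)) subrKA.
  apply: le_trans (ler_normD _ _) _.
  have g1 : `|dot (Y v - Y u) (z v - zb v)| <= Dd * `|Y v - Y u| * rho.
    by apply: le_trans (dotD _ _) _; rewrite ler_wpM2l ?mulr_ge0// zr.
  have g2 := dotY u (z v - zb v - (z u - zb u)) _ uT (lexx _).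
  have p1 : 0 <= Dd * `|Y v - Y u| * YB by rewrite !mulr_ge0.
  have p2 : 0 <= Dd * `|z v - zb v - (z u - zb u)| * rho by rewrite !mulr_ge0// ltW.
  apply: le_trans (lerD g1 g2) _.
  have -> : Dd * (YB + rho) * (`|Y v - Y u| + `|z v - zb v - (z u - zb u)|) =
    (Dd * `|Y v - Y u| * rho + DY * `|z v - zb v - (z u - zb u)|) +
    (Dd * `|Y v - Y u| * YB + Dd * `|z v - zb v - (z u - zb u)| * rho) by rewrite /DY; ring.
  by rewrite lerDl addr_ge0.
pose q := mismatch h.
(* [sg * q] is the signed length, so [sg * q T = h] *)
pose g t := w t - sg * jump * q t.
pose m t := k1 * `|h| ^+ 2 * t + (k2 * `|h| + e / 2) * q t.
have acq : abs_continuous 0 T q.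
  apply: (@lipschitz_abs_continuous _ _ _ _ _ 1) => u v _ uv _.
  rewrite /q /mismatch opprB addrA subrK mul1r ger0_norm ?subr_ge0 ?clamp_mono//.
  exact: clamp_lip.
have acg : abs_continuous 0 T g.
  apply: (@abs_continuous_dom _ _ _ _ _ w q _ _ (1 + `|sg * jump|)) => //.
  move=> u v _ _ _; rewrite /g subrACA -mulrBr; apply: le_trans (ler_normB _ _) _.
  rewrite normrM mulrDl mul1r; apply: lerD; first by rewrite lerDl.
  by rewrite ler_wpM2l// lerDr.
have := @mean_value_ae R _ g m 0 T horizon_ge0 acg.
have -> : g T - g 0 = dot (Y T) (z T - zb T) - h * jump.
  have w0 : w 0 = 0.
    by rewrite /w z0 (dotr (zb 0)) subrr.
  rewrite /g w0 /q (mismatchT hs) (mismatch0 hs) mulr0 subr0 subr0 mulrAC sgh.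
  by rewrite /w.
have -> : m T - m 0 = k1 * `|h| ^+ 2 * T + (k2 * `|h| + e / 2) * `|h|.
  by rewrite /m /q (mismatchT hs) (mismatch0 hs); ring.
move=> H.
apply: (@le_trans _ _ (k1 * `|h| ^+ 2 * T + (k2 * `|h| + e / 2) * `|h|)); last first.
  have h2 : N * `|h| <= e / 2 by rewrite mulrC -ler_pdivlMr// ltW.
  have h3 : (k1 * T + k2) * `|h| <= N * `|h|.
    by rewrite ler_wpM2r// /N; lra.
  have -> : k1 * `|h| ^+ 2 * T + (k2 * `|h| + e / 2) * `|h| =
    ((k1 * T + k2) * `|h| + e / 2) * `|h| by ring.
  by rewrite ler_wpM2r//; lra.
apply: H.
  move=> u v u0 uv vT; apply: lerD.
    by rewrite ler_wpM2l// mulr_ge0// exprn_ge0.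
  apply: ler_wpM2l; last exact: mismatch_mono.
  by rewrite addr_ge0 ?mulr_ge0// ltW.
apply: (ae_mono _ (ae_and (ae_and (ae_fields hs) dY) (ae_and dz dzb))).
move=> t [[ft dYt] [dzt dzbt]] t0T.
have tT : 0 <= t <= T by case/andP: t0T => *; rewrite !ltW.
have [i [i' [ik ik' si si' fi]]] := ft t0T.
have [Y' dY' Y'E] := dYt i ik si.
have d1 := dzt i' ik' si'; have d2 := dzbt i ik si.
have hw : has_deriv w t (dot Y' (z t - zb t) + dot (Y t) (G i' (z t) t - G i (zb t) t)).
  by apply: (has_deriv_bilinear dotl dotr dotZl dotZr dotD) => //; exact: has_derivB.
have wi : lo i <= t <= hi i.
  have /andP[a1 a2] := si.
  by rewrite (le_trans (slo ik) (ltW a1)) (le_trans (ltW a2) (shi ik)).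
have wi' : lo i' <= t <= hi i'.
  have /andP[a1 a2] := si'.
  by rewrite (le_trans (move_switch_lo hs ik') (ltW a1))
    (le_trans (ltW a2) (move_switch_hi hs ik')).
have zt := zr t tT; have zbt : `|zb t - zb t| <= rho by rewrite subrr normr0 ltW.
set rem := G i (z t) t - G i (zb t) t - DG i t (z t - zb t).
have hrem : `|dot (Y t) rem| <= k1 * `|h| ^+ 2.
  rewrite /k1 -mulrA; apply: dotY => //.
  have [_ _ _ _ GQ] := GM ik.
  have := GQ t (z t - zb t) wi zt; rewrite (addrC (zb t)) subrK => hq.
  apply: le_trans hq _; rewrite -mulrA ler_pM2l// -exprMn.
  have cz := zd t tT.
  by rewrite !expr2 ler_pM.
have hwE : dot Y' (z t - zb t) + dot (Y t) (G i' (z t) t - G i (zb t) t) =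
  dot (Y t) rem + dot (Y t) (G i' (z t) t - G i (z t) t).
  by rewrite Y'E /rem !(dotr (G _ _ _)) (dotr (_ - _)) (dotr (G _ _ _)); ring.
rewrite {}hwE in hw.
have hmt : has_deriv (fun t => k1 * `|h| ^+ 2 * t) t (k1 * `|h| ^+ 2 * 1).
  by apply: has_deriv_scale; exact: has_deriv_id.
case: fi => [[ii' dm]|[dm ttau sw]].
  exists (dot (Y t) rem + dot (Y t) (G i' (z t) t - G i (z t) t) - sg * jump * 0).
  exists (k1 * `|h| ^+ 2 * 1 + (k2 * `|h| + e / 2) * 0); split.
  - by apply: has_derivB => //; exact: has_deriv_scale.
  - by apply: has_derivD => //; exact: has_deriv_scale.
  - by rewrite !mulr0 subr0 addr0 mulr1 ii' (dotr (G _ _ _)) subrr addr0.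
exists (dot (Y t) rem + dot (Y t) (G i' (z t) t - G i (z t) t) - sg * jump * 1).
exists (k1 * `|h| ^+ 2 * 1 + (k2 * `|h| + e / 2) * 1); split.
- by apply: has_derivB => //; exact: has_deriv_scale.
- by apply: has_derivD => //; exact: has_deriv_scale.
rewrite !mulr1 -addrA; apply: le_trans (ler_normD _ _) _; apply: lerD => //.
have [GL _ _ _ _] := GM ik; have [GL' _ _ _ _] := GM ik'.
set D0 := G i' (zb t) t - G i (zb t) t.
have E1 : G i' (z t) t - G i (z t) t =
    (G i' (z t) t - G i' (zb t) t - (G i (z t) t - G i (zb t) t)) + D0.
  by rewrite /D0 [X in _ = X + _]subrACA subrK.
have hk2 : `|dot (Y t) (G i' (z t) t - G i' (zb t) t - (G i (z t) t - G i (zb t) t))| <= k2 * `|h|.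
  rewrite /k2 -mulrA; apply: dotY => //; apply: le_trans (ler_normB _ _) _.
  have h5 := GL t _ _ wi zt zbt; have h6 := GL' t _ _ wi' zt zbt.
  have h7 : M * `|z t - zb t| <= M * (C * `|h|) by rewrite ler_pM2l// zd.
  apply: le_trans (lerD h6 h5) _; rewrite /=; lra.
have hD0 : `|dot (Y t) D0 - sg * jump| <= e / 2.
  have tw : lo j.+1 <= t <= hi j.
    by case: sw => -[_ [E2 E3]]; rewrite E2 in wi; rewrite E3 in wi';
      case/andP: wi => a1 a2; case/andP: wi' => a3 a4; apply/andP.
  have := Hd t (le_lt_trans ttau hd) tw.
  case: sw => -[h0 [E2 E3]]; rewrite /D0 /sg E2 E3.
    by rewrite h0 mul1r.
  rewrite ltNge (ltW h0)/= => hj.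
  rewrite (_ : _ - _ = - (dot (Y t) (G j (zb t) t - G j.+1 (zb t) t) - jump)) ?normrN//.
  by rewrite !(dotr (G _ _ _)); ring.
have -> : dot (Y t) (G i' (z t) t - G i (z t) t) - sg * jump =
  dot (Y t) (G i' (z t) t - G i' (zb t) t - (G i (z t) t - G i (zb t) t))
  + (dot (Y t) D0 - sg * jump).
  rewrite [RHS]addrA; congr (_ - _); rewrite E1.
  exact: dotDr.
by apply: le_trans (ler_normD _ _) _; exact: lerD.
Qed.

End Adjoint.
End Sensitivity.

(** * The coupled system as a switched system *)

Section Switch.
Variables (R : realType) (k : nat) (T : R).
Implicit Types s : 'rV[R]_k.

Lemma switch0 s : switch T s 0 = 0. Proof. by []. Qed.

Lemma switch_last s : switch T s k.+1 = T.
Proof. by rewrite /switch nth_default//= size_map size_enum_ord. Qed.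

Lemma switchS s (i : 'I_k) : switch T s i.+1 = s 0 i.
Proof. by rewrite /switch/= (nth_map i) ?size_enum_ord// nth_ord_enum. Qed.

Lemma switch_shift s (j : 'I_k) h :
  switch T (h *: delta_mx 0 j + s) = move_switch (switch T s) j.+1 h.
Proof.
apply/funext => -[|i]; rewrite /move_switch/= ?switch0//.
have [ik|ki] := ltnP i k.
  rewrite !(switchS _ (Ordinal ik)) !mxE eqxx/= eqSS.
  rewrite (_ : (Ordinal ik == j) = (i == j))//.
  by case: eqP => _; rewrite ?mulr1 ?mulr0 ?add0r// addrC.
rewrite eqSS gtn_eqF ?(leq_trans (ltn_ord j))//.
by rewrite /switch !nth_default//= size_map size_enum_ord.
Qed.

End Switch.

Section Pairs.
Variables (R : realType) (V W : normedModType R).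

Lemma has_deriv_fst (z : R -> V * W) t l : has_deriv z t l ->
  has_deriv (fun u => (z u).1) t l.1.
Proof.
move=> zl e e0; apply: filterS (zl e e0) => u; apply: le_trans.
exact: (pair_fst_le (z u - z t - (u - t) *: l)).
Qed.

Lemma has_deriv_snd (z : R -> V * W) t l : has_deriv z t l ->
  has_deriv (fun u => (z u).2) t l.2.
Proof.
move=> zl e e0; apply: filterS (zl e e0) => u; apply: le_trans.
exact: (pair_snd_le (z u - z t - (u - t) *: l)).
Qed.

Lemma abs_continuous_pair a b (x : R -> V) (y : R -> W) :
  abs_continuous a b x -> abs_continuous a b y ->
  abs_continuous a b (fun t => (x t, y t)).
Proof.
move=> acx acy; apply: (@abs_continuous_dom _ _ _ _ _ x y _ _ 1) => //.
by move=> u v _ _ _; rewrite mul1r; apply: pair_norm_le; rewrite /= ?lerDl ?lerDr.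
Qed.

Lemma abs_continuous_fst a b (z : R -> V * W) :
  abs_continuous a b z -> abs_continuous a b (fun t => (z t).1).
Proof.
move=> acz; apply: (@abs_continuous_dom _ _ _ _ _ z z _ _ 1) => //.
move=> u v _ _ _; rewrite mul1r; apply: (le_trans (pair_fst_le (z v - z u))).
by rewrite lerDl.
Qed.

Lemma abs_continuous_snd a b (z : R -> V * W) :
  abs_continuous a b z -> abs_continuous a b (fun t => (z t).2).
Proof.
move=> acz; apply: (@abs_continuous_dom _ _ _ _ _ z z _ _ 1) => //.
move=> u v _ _ _; rewrite mul1r; apply: (le_trans (pair_snd_le (z v - z u))).
by rewrite lerDl.
Qed.

End Pairs.

Lemma ae_forall_le (R : realType) (k : nat) (P : nat -> R -> Prop) :
  (forall i, (i <= k)%N -> {ae @lebesgue_measure R, forall t, P i t}) ->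
  {ae @lebesgue_measure R, forall t i, (i <= k)%N -> P i t}.
Proof.
move=> H; apply: ae_foralln => i.
have [ik|ki] := leqP i k; first by apply: ae_mono (H i ik) => t Pt _.
by apply: aeW => t.
Qed.

Section Coupled.
Variables (R : realType) (n m k : nat) (T : R).
Variable f : 'rV[R]_n -> 'rV[R]_m -> 'rV[R]_n.
Variable phi : nat -> 'rV[R]_n -> 'rV[R]_n -> R -> 'rV[R]_m.
Local Notation V := ('rV[R]_n * 'rV[R]_n)%type.
Local Notation W := ('rV[R]_n * 'M[R]_n)%type.

Definition dyn_pair (i : nat) (c : V) (t : R) : W :=
  (dyn f phi i c.1 c.2 t, dynx f phi i c.1 c.2 t).

Local Notation G := (fun i => costate_field (dyn_pair i)).

Lemma coupled_switched (s : 'rV[R]_k) x0 p0 x p : coupled_solution T f phi s x0 p0 x p ->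
  switched_solution k T G (switch T s) (x0, p0) (fun t => (x t, p t)).
Proof.
move=> [acx acp x00 p00 dxp]; split; first by rewrite x00 p00.
  exact: abs_continuous_pair.
apply: (ae_mono _ (ae_forall_le dxp)) => t H i ik st; have [dx dp] := H i ik st.
by apply: has_deriv_pair; apply/has_derivP.
Qed.

Lemma switched_coupled (s : 'rV[R]_k) x0 p0 z :
  switched_solution k T G (switch T s) (x0, p0) z ->
  coupled_solution T f phi s x0 p0 (fun t => (z t).1) (fun t => (z t).2).
Proof.
move=> [z0 acz dz]; split; [exact: abs_continuous_fst|exact: abs_continuous_snd| | |].
- by rewrite z0.
- by rewrite z0.
- move=> i ik; apply: (ae_mono _ dz) => t H st; have dzt := H i ik st.
  by split; apply/has_derivP; [exact: (has_deriv_fst dzt)|exact: (has_deriv_snd dzt)].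
Qed.

(** The choice made in [cost] is harmless: whatever terminal state is chosen, it is reached
    by some solution. *)
Lemma cost_attained C x0 (s : 'rV[R]_k) p0 :
  (exists z, switched_solution k T G (switch T s) (x0, p0) z) ->
  exists2 z, switched_solution k T G (switch T s) (x0, p0) z &
    cost T f phi C x0 s p0 = C (z T).1.
Proof.
move=> [z zsol].
pose S := [set xT | exists x p, coupled_solution T f phi s x0 p0 x p /\ x T = xT].
have [x [p [xpsol xT]]] : S (xget 0 S).
  apply: xgetPex; exists (z T).1, (fun t => (z t).1), (fun t => (z t).2).
  by split => //; exact: switched_coupled.
exists (fun t => (x t, p t)); first exact: coupled_switched.
by rewrite /= xT.
Qed.

Definition pairing (a b : V) : R := (a.1 *m b.1^T + a.2 *m b.2^T) 0 0.

Lemma pairing_Bl u v w : pairing (u - v) w = pairing u w - pairing v w.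
Proof. by rewrite /pairing/= !mulmxBl !mxE; ring. Qed.
Lemma pairing_Br u v w : pairing w (u - v) = pairing w u - pairing w v.
Proof. by rewrite /pairing/= !linearB/= !mxE; ring. Qed.
Lemma pairing_Zl c u v : pairing (c *: u) v = c * pairing u v.
Proof. by rewrite /pairing/= -!scalemxAl !mxE; ring. Qed.
Lemma pairing_Zr c u v : pairing u (c *: v) = c * pairing u v.
Proof. by rewrite /pairing/= !linearZ/= ?mxE; ring. Qed.
Lemma pairing_bound u v : `|pairing u v| <= (n%:R + n%:R) * `|u| * `|v|.
Proof.
have h (a b : 'rV[R]_n) : `|a| <= `|u| -> `|b| <= `|v| ->
    `|(a *m b^T) 0 0| <= n%:R * `|u| * `|v|.
  move=> au bv; apply: le_trans (mx_entry_le _ _ _) _.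
  apply: le_trans (mulmx_norm_le _ _) _; rewrite trmx_norm.
  by apply: ler_pM => //; apply: ler_wpM2l.
rewrite /pairing mxE; apply: le_trans (ler_normD _ _) _; rewrite !mulrDl.
by apply: lerD; apply: h; rewrite ?pair_fst_le ?pair_snd_le.
Qed.

(** The generalized Hamiltonian is the pairing of the adjoint variable with the field. *)
Lemma hamiltonianE i x p y1 y2 t :
  hamiltonian f phi i x p y1 y2 t = pairing (y1, y2) (G i (x, p) t).
Proof.
rewrite /hamiltonian /pairing /= linearN/= mulmxN.
have -> : y2 *m (p *m dynx f phi i x p t)^T = (p *m dynx f phi i x p t *m y2^T)^T.
  by rewrite [RHS]trmx_mul trmxK.
by rewrite !mxE.
Qed.

(** Partial derivatives of the Hamiltonian, read off from a quadratic remainder estimate.  The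
    map [e] inserts a row vector in one of the two components of the center. *)
Lemma pairing_field_derive (H : V -> V) (c Y d l : V) (e : 'rV[R]_n -> V)
    (a v : 'rV[R]_n) (rho M : R) : 0 < rho -> 0 <= M ->
  (forall h, e (h *: v + a) = c + h *: d) ->
  (forall h : R, `|h *: d| <= rho -> `|H (c + h *: d) - H c - h *: l| <= M * `|h *: d| ^+ 2) ->
  'D_v (fun z => pairing Y (H (e z))) a = pairing Y l.
Proof.
move=> rho0 M0 eE HH.
have ea : e a = c by have := eE 0; rewrite !scale0r add0r addr0.
suff : is_derive a v (fun z => pairing Y (H (e z))) (pairing Y l) by case.
apply/is_derive_epsP => r r0; rewrite ea.
pose N := (n%:R + n%:R) * `|Y| * M * `|d| ^+ 2 + 1.
have N0 : 0 < N by rewrite ltr_wpDl// !mulr_ge0// ?exprn_ge0// addr_ge0.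
have d1 : 0 < `|d| + 1 by rewrite ltr_wpDl.
near=> h.
have hN : `|h| < r / N.
  near: h; have := @near_dist R 0 _ (divr_gt0 r0 N0).
  by apply: filterS => u; rewrite subr0.
have hd : `|h| < rho / (`|d| + 1).
  near: h; have := @near_dist R 0 _ (divr_gt0 rho0 d1).
  by apply: filterS => u; rewrite subr0.
have hr : `|h *: d| <= rho.
  rewrite ltr_pdivlMr// in hd; rewrite normrZ; apply: le_trans (ltW hd).
  by rewrite ler_wpM2l// lerDl.
rewrite eE.
have -> : pairing Y (H (c + h *: d)) - pairing Y (H c) - h *: pairing Y l =
   pairing Y (H (c + h *: d) - H c - h *: l).
  by rewrite !pairing_Br pairing_Zr.
apply: le_trans (pairing_bound _ _) _.
have h1 : (n%:R + n%:R) * `|Y| * `|H (c + h *: d) - H c - h *: l| <=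
    (n%:R + n%:R) * `|Y| * (M * (`|h| * `|d|) ^+ 2).
  by rewrite ler_wpM2l ?mulr_ge0 ?addr_ge0// -normrZ; exact: HH.
apply: le_trans h1 _.
have -> : (n%:R + n%:R) * `|Y| * (M * (`|h| * `|d|) ^+ 2) = (N - 1) * `|h| * `|h|.
  by rewrite /N; ring.
rewrite ler_wpM2r//; move: hN; rewrite ltr_pdivlMr// mulrC => /ltW.
have := normr_ge0 h; lra.
Unshelve. all: by end_near.
Qed.

Lemma mulmx_trE (a b : 'rV[R]_n) : (a *m b^T) 0 0 = \sum_l a 0 l * b 0 l.
Proof. by rewrite mxE; apply: eq_bigr => l _; rewrite mxE. Qed.

Lemma pairing_Dr u v w : pairing w (u + v) = pairing w u + pairing w v.
Proof. by rewrite -{1}[v]opprK pairing_Br -[- v]scaleN1r pairing_Zr; ring. Qed.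

(** The adjoint equation in one formula: expand [v] in the two canonical bases, on which the
    entries of the gradients are values of the pairing with [DG]. *)
Lemma adjoint_pairing i (xt pt y1 y2 : 'rV[R]_n) t (rho M : R) (DG : V -> V) v :
  0 < rho -> 0 <= M ->
  (forall k u w, DG (k *: u + w) = k *: DG u + DG w) ->
  (forall d, `|d| <= rho -> `|G i ((xt, pt) + d) t - G i (xt, pt) t - DG d| <= M * `|d| ^+ 2) ->
  pairing (- gradient (fun z => hamiltonian f phi i z pt y1 y2 t) xt,
           - gradient (fun q => hamiltonian f phi i xt q y1 y2 t) pt) v =
  - pairing (y1, y2) (DG v).
Proof.
move=> rho0 M0 DGlin DGq.
have DGZ h d : DG (h *: d) = h *: DG d.
  have DG0 : DG 0 = 0.
    have := DGlin 1 0 0; rewrite !scale1r addr0 => /eqP.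
    by rewrite -subr_eq0 opprD addrA subrr sub0r oppr_eq0 => /eqP.
  by rewrite -[h *: d]addr0 DGlin DG0 addr0.
have quad d (h : R) : `|h *: d| <= rho ->
    `|G i ((xt, pt) + h *: d) t - G i (xt, pt) t - h *: DG d| <= M * `|h *: d| ^+ 2.
  by move=> hd; rewrite -DGZ; exact: DGq.
have g1 l : gradient (fun z => hamiltonian f phi i z pt y1 y2 t) xt 0 l =
    pairing (y1, y2) (DG (delta_mx 0 l, 0)).
  rewrite mxE (_ : (fun z => _) = fun z => pairing (y1, y2) (G i (z, pt) t)); last first.
    by apply/funext => z; exact: hamiltonianE.
  apply: (@pairing_field_derive (fun c => G i c t) (xt, pt) (y1, y2)
    (delta_mx 0 l, 0) _ (fun z => (z, pt)) _ _ _ _ rho0 M0 _ (quad _)) => h.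
  by congr (_, _); rewrite /= ?scaler0 ?addr0// addrC.
have g2 l : gradient (fun q => hamiltonian f phi i xt q y1 y2 t) pt 0 l =
    pairing (y1, y2) (DG (0, delta_mx 0 l)).
  rewrite mxE (_ : (fun z => _) = fun q => pairing (y1, y2) (G i (xt, q) t)); last first.
    by apply/funext => z; exact: hamiltonianE.
  apply: (@pairing_field_derive (fun c => G i c t) (xt, pt) (y1, y2)
    (0, delta_mx 0 l) _ (fun z => (xt, z)) _ _ _ _ rho0 M0 _ (quad _)) => h.
  by congr (_, _); rewrite /= ?scaler0 ?addr0// addrC.
case: v => v1 v2.
have -> : DG (v1, v2) = DG (v1, 0) + DG (0, v2).
  rewrite -[X in X + _]scale1r -DGlin scale1r; congr DG.
  by congr (_, _); rewrite /= ?addr0 ?add0r.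
rewrite pairing_Dr.
have F1 : pairing (y1, y2) (DG (v1, 0)) = \sum_l v1 0 l * pairing (y1, y2) (DG (delta_mx 0 l, 0)).
  apply: (@linear_row_sum R n R^o (fun u => pairing (y1, y2) (DG (u, 0)))) => k0 u w.
  have -> : (k0 *: u + w, 0) = k0 *: (u, 0) + (w, 0) :> V.
    by congr (_, _); rewrite /= scaler0 addr0.
  by rewrite DGlin pairing_Dr pairing_Zr.
have F2 : pairing (y1, y2) (DG (0, v2)) = \sum_l v2 0 l * pairing (y1, y2) (DG (0, delta_mx 0 l)).
  apply: (@linear_row_sum R n R^o (fun u => pairing (y1, y2) (DG (0, u)))) => k0 u w.
  have -> : (0, k0 *: u + w) = k0 *: (0, u) + (0, w) :> V.
    by congr (_, _); rewrite /= scaler0 addr0.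
  by rewrite DGlin pairing_Dr pairing_Zr.
rewrite F1 F2 /pairing mxE /= !mulmx_trE opprD -!sumrN.
congr (_ + _); apply: eq_bigr => l _; rewrite mxE.
  by rewrite g1 mulNr mulrC.
by rewrite g2 mulNr mulrC.
Qed.

Lemma gradient_mul (C : 'rV[R]_n -> R) a d : differentiable C a ->
  (gradient C a *m d^T) 0 0 = 'd C a d.
Proof.
move=> dC; rewrite mulmx_trE (@linear_row_sum R n R^o ('d C a) d); last first.
  by move=> k0 u w; rewrite linearP.
by apply: eq_bigr => l _; rewrite mxE deriveE// mulrC.
Qed.

Lemma differentiable_eps (C : 'rV[R]_n -> R) a (e : R) : differentiable C a ->
  0 < e -> exists2 r : R, 0 < r &
    forall d, `|d| < r -> `|C (a + d) - C a - 'd C a d| <= e * `|d|.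
Proof.
move=> dC e0; have /eqaddoP/(_ e e0) := diff_locally dC.
move=> /nbhs_ballP[r /= r0 Hr]; exists r => // d dr.
have := Hr d; rewrite -ball_normE /= sub0r normrN => /(_ dr).
move=> H; have {}H : `|C (d + a) - (C a + 'd C a d)| <= e * `|d| := H.
by move: H; rewrite opprD addrA (addrC d).
Qed.

End Coupled.

Lemma field_bounds_le (R : realType) (V : normedModType R) (G : V -> R -> V) zb
    (rho a b M N : R) DG : M <= N -> field_bounds G zb rho a b M DG ->
  field_bounds G zb rho a b N DG.
Proof.
move=> MN [GL GK GC Dlin GQ]; split => //.
- move=> t c c' tab h h'; apply: le_trans (GL t c c' tab h h') _.
  by rewrite ler_wpM2r.
- by move=> t c tab h; apply: le_trans (GK t c tab h) MN.
- move=> t v tab h; apply: le_trans (GQ t v tab h) _.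
  by rewrite ler_wpM2r// exprn_ge0.
Qed.

(** * The derivative of the cost *)

Theorem mainTheorem3 (R : realType) (n m k : nat) (T : R)
    (f : 'rV[R]_n -> 'rV[R]_m -> 'rV[R]_n) (C : 'rV[R]_n -> R)
    (phi : nat -> 'rV[R]_n -> 'rV[R]_n -> R -> 'rV[R]_m)
    (s : 'rV[R]_k) (x0 p0 : 'rV[R]_n) (x p y1 y2 : R -> 'rV[R]_n) :
  0 < T ->
  (forall z : 'rV[R]_n * 'rV[R]_m,
     differentiable (fun z : 'rV[R]_n * 'rV[R]_m => f z.1 z.2) z) ->
  (forall z : 'rV[R]_n, differentiable C z) ->
  (forall j, (j <= k)%N -> switch T s j < switch T s j.+1) ->
  coupled_solution T f phi s x0 p0 x p ->
  generalized_state_regularity T f phi s x p ->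
  (exists2 U : set 'rV[R]_n, nbhs (x T) U & [lipschitz gradient C z | z in U]) ->
  adjoint_solution T f phi C s x p y1 y2 ->
  forall j : 'I_k,
    is_derive s (delta_mx 0 j) (fun s' : 'rV[R]_k => cost T f phi C x0 s' p0)
      (hamiltonian f phi j (x (s 0 j)) (p (s 0 j))
         (y1 (s 0 j)) (y2 (s 0 j)) (s 0 j) -
       hamiltonian f phi j.+1 (x (s 0 j)) (p (s 0 j))
         (y1 (s 0 j)) (y2 (s 0 j)) (s 0 j)).
Proof.
move=> T0 _ dC smono xpsol [rho [sm [sp [L [rho0 [sm0 spT] ssm tubes]]]]] _ adj j.
set V := ('rV[R]_n * 'rV[R]_n)%type.
pose ss := switch T s.
pose zb t : V := (x t, p t).
pose Y t : V := (y1 t, y2 t).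
pose G i := costate_field (dyn_pair f phi i).
pose lo := sm; pose hi i := sp i.+1.
have jk := ltn_ord j.
have ss0 : ss 0%N = 0 := switch0 T s.
have ssT : ss k.+1 = T := switch_last T s.
have zbsol0 := coupled_switched xpsol.
have zbE : zb 0 = (x0, p0) by case: zbsol0.
have zbsol : switched_solution k T G ss (zb 0) zb by rewrite zbE.
have slo i : (i <= k)%N -> lo i <= ss i.
  case: i => [|i] ik; first by rewrite /lo sm0 ss0.
  by have [/andP[_ /ltW]] := ssm i.+1 ik.
have shi i : (i <= k)%N -> ss i.+1 <= hi i.
  rewrite leq_eqVlt => /orP[/eqP->|ik]; first by rewrite /hi spT ssT.
  by have [_ /andP[/ltW]] := ssm i.+1 ik.
have lo0 i : (i <= k)%N -> 0 <= lo i.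
  case: i => [|i] ik; first by rewrite /lo sm0.
  have [/andP[h1 _] _] := ssm i.+1 ik; apply: le_trans (ltW h1).
  by have := @switching_le R k ss smono 0%N i isT (leqW (ltnW ik)); rewrite ss0.
have hiT i : (i <= k)%N -> hi i <= T.
  rewrite leq_eqVlt => /orP[/eqP->|ik]; first by rewrite /hi spT.
  have [_ /andP[_ h1]] := ssm i.+1 ik; apply: le_trans (ltW h1) _.
  by have := @switching_le R k ss smono i.+2 k.+1 ik (leqnn _); rewrite ssT.
have lohi i : (i <= k)%N -> lo i <= hi i.
  by move=> ik; rewrite (le_trans (slo i ik))// (le_trans (ltW (smono i ik)))// shi.
have [/andP[jlo loj] /andP[jhi hij]] := ssm j.+1 jk.
have fb i : exists MD : R * (R -> V -> V), (i <= k)%N ->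
    0 <= MD.1 /\ field_bounds (G i) zb rho (lo i) (hi i) MD.1 MD.2.
  have [ik|ki] := leqP i k; last by exists (0, fun=> id).
  have [dg [Bdg dgL]] := tubes i ik.
  have tubeE : tube x p rho (sm i) (sp i.+1) =
      [set z | lo i <= z.2 <= hi i /\ `|zb z.2 - z.1| <= rho].
    by apply/seteqP; split=> z [h1 h2]; split=> //; move: h2; rewrite closed_ballE.
  rewrite tubeE in Bdg dgL.
  have czb : continuous (zb \o clamp (lo i) (hi i)).
    case: zbsol => _ aczb _.
    apply: continuous_abs_clamp; first exact: lohi.
    exact: (abs_continuous_sub (lo0 i ik) (hiT i ik) aczb).
  have [M [M0 HM]] := costate_field_bounds (B := dyn_pair f phi i) rho0 (lohi i ik) czb Bdg dgL.
  by exists (M, costate_field_diff (dyn_pair f phi i) zb dg).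
have [MD HMD] := choice fb.
pose M := 1 + \sum_(i < k.+1) `|(MD i).1|.
have M0 : 0 < M by rewrite ltr_pwDl// sumr_ge0.
pose DG i := (MD i).2.
have GM i : (i <= k)%N -> field_bounds (G i) zb rho (lo i) (hi i) M (DG i).
  move=> ik; have [h1 h2] := HMD i ik; apply: field_bounds_le h2.
  rewrite /M (bigD1 (Ordinal (ik : (i < k.+1)%N)))//= ger0_norm//.
  by rewrite addrCA lerDl addr_ge0// sumr_ge0.
have [acy1 acy2 y1T y2T dy] := adj.
have acY : abs_continuous 0 T Y by exact: abs_continuous_pair.
have dY : {ae @lebesgue_measure R, forall t i, (i <= k)%N -> ss i < t < ss i.+1 ->
    exists2 Y', has_deriv Y t Y' & forall v, pairing Y' v = - pairing (Y t) (DG i t v)}.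
  apply: (ae_mono _ (ae_forall_le dy)) => t H i ik st; have [d1 d2] := H i ik st.
  have wt : lo i <= t <= hi i.
    by case/andP: st => a b; rewrite (le_trans (slo i ik) (ltW a)) (le_trans (ltW b) (shi i ik)).
  exists (- gradient (fun z => hamiltonian f phi i z (p t) (y1 t) (y2 t) t) (x t),
          - gradient (fun q => hamiltonian f phi i (x t) q (y1 t) (y2 t) t) (p t)).
    by apply: has_deriv_pair; apply/has_derivP.
  move=> v; have [_ _ _ Dlin GQ] := GM i ik.
  apply: (@adjoint_pairing R n m f phi i (x t) (p t) (y1 t) (y2 t) t rho M (DG i t) v
    rho0 (ltW M0) (Dlin t)).
  by move=> d hd; exact: GQ.
have Dd0 : 0 <= n%:R + n%:R :> R by rewrite addr_ge0.
have fo := first_order_effect jk ss0 ssT smono slo shi jlo loj jhi hij rho0 M0 GM zbsol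
  (@pairing_Bl R n) (@pairing_Br R n) (@pairing_Zl R n) (@pairing_Zr R n)
  (@pairing_bound R n) Dd0 acY dY.
have db := drift_bound jk ss0 ssT smono slo shi jlo loj jhi hij rho0 M0 GM zbsol.
have ex := @shifted_solution R V
  (has_primitives_pair (@has_primitives_rV R n) (@has_primitives_rV R n))
  (geometric_complete_pair (@geometric_complete_rV R n) (@geometric_complete_rV R n))
  k T ss lo hi G DG zb rho M j jk ss0 ssT smono slo shi jlo loj jhi hij rho0 M0 GM zbsol.
have sr0 : 0 < shift_range ss lo hi j := shift_range_gt0 loj jhi.
have tauE : ss j.+1 = s 0 j := switchS T s j.
have TT : 0 <= T <= T by rewrite lexx ltW.
have costE h : `|h| < shift_range ss lo hi j -> drift T M h < rho ->
  exists2 z, switched_solution k T G (move_switch ss j.+1 h) (zb 0) z &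
    cost T f phi C x0 (h *: delta_mx 0 j + s) p0 = C (z T).1.
  move=> h1 h2; have := @cost_attained R n m k T f phi C x0 (h *: delta_mx 0 j + s) p0.
  by rewrite switch_shift -zbE; apply; exact: ex.
have drift0 : drift T M 0 = 0 by rewrite /drift normr0 mulr0 mul0r.
(* the case [h = 0] of the drift bound: solutions for [s] have a unique terminal state *)
have cost0 : cost T f phi C x0 s p0 = C (x T).
  have [||z zsol] := costE 0; rewrite ?normr0 ?drift0//.
  rewrite scale0r add0r => ->; congr C.
  have := db 0 _ _ z zsol T TT; rewrite normr0 drift0 => /(_ sr0 rho0).
  by rewrite normr_le0 subr_eq0 => /eqP ->.
have jumpE : hamiltonian f phi j (x (s 0 j)) (p (s 0 j)) (y1 (s 0 j)) (y2 (s 0 j)) (s 0 j) -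
    hamiltonian f phi j.+1 (x (s 0 j)) (p (s 0 j)) (y1 (s 0 j)) (y2 (s 0 j)) (s 0 j) =
    jump ss G zb j (@pairing R n) Y.
  by rewrite /jump tauE pairing_Br !hamiltonianE.
rewrite jumpE; set J := jump _ _ _ _ _ _.
have pairYT (v : V) : pairing (Y T) v = 'd C (x T) v.1.
  by rewrite /pairing /= y1T y2T mul0mx addr0 gradient_mul.
apply/is_derive_epsP => e e0; rewrite cost0.
pose D := 4 * M * expR (2 * M * T).
have D0 : 0 <= D by rewrite !mulr_ge0 ?expR_ge0// ltW.
have D1 : 0 < D + 1 by rewrite ltr_wpDl.
have driftE h : drift T M h = D * `|h| by rewrite /drift mulrAC.
have e20 : 0 < e / 2 by rewrite divr_gt0.
have [r r0 Hr] := differentiable_eps (dC (x T)) (divr_gt0 e20 D1).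
have [eta eta0 Heta] := fo _ e20.
have small (c : R) : 0 < c -> \forall h \near (0 : R), D * `|h| < c.
  move=> c0; apply: filterS (near_dist 0 (divr_gt0 c0 D1)) => h.
  rewrite subr0 ltr_pdivlMr// => hc; apply: le_lt_trans hc.
  by rewrite mulrC ler_wpM2l// lerDl.
have N1 := near_dist 0 eta0; have N2 := near_dist 0 sr0.
apply: filterS (filterI (filterI N1 N2) (filterI (small _ rho0) (small _ r0))).
move=> h [[]]; rewrite !subr0 => h1 h2 [h3 h4].
rewrite -driftE in h3.
have [z zsol ->] := costE h h2 h3.
have zd := db h h2 h3 z zsol T TT; rewrite driftE in zd.
pose d := (z T).1 - x T.
have dd : `|d| <= D * `|h| by apply: le_trans zd; exact: (pair_fst_le (z T - zb T)).
have := Heta h z h1 h2 h3 zsol; rewrite pairYT -/J => k2.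
have dE : x T + d = (z T).1 by rewrite /d addrC subrK.
have := Hr d (le_lt_trans dd h4); rewrite dE => k1.
have -> : C (z T).1 - C (x T) - h *: J =
    (C (z T).1 - C (x T) - 'd C (x T) d) + ('d C (x T) d - h * J).
  by rewrite [RHS]subrKA.
apply: le_trans (ler_normD _ _) _.
have k3 : e / 2 / (D + 1) * `|d| <= e / 2 * `|h|.
  rewrite -mulrA ler_pM2l// mulrC ler_pdivrMr//; apply: le_trans dd _.
  by rewrite mulrC ler_wpM2l// lerDl.
by apply: le_trans (lerD (le_trans k1 k3) k2) _; rewrite -mulrDl -splitr.
Qed.
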